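(* Let $w\in S_\infty$, let $k<l$, and let $\eta=\eta_1+2\eta_2\in B_{k,l}(w)$ with $|\eta_1|+2|\eta_2|=k+l$ and $k=|\eta_2|+2$ (so $|\eta_1|=l-k+4$). Write the elements of $\eta_1$ in increasing order as $\gamma_1<\gamma_2<\dots<\gamma_{l-k+4}$, and let $a<b$ and $c<d$ be the indices with $\beta_{\min}=\eta_2\cup\{\gamma_a,\gamma_b\}$ and $\beta_{\max}=\eta_2\cup\{\gamma_c,\gamma_d\}$. Set $\varepsilon=1$ if $b>c$ and $\varepsilon=0$ if $b<c$. Then $m^{k,l}_\eta(w)=d-a+1-\varepsilon(b-c)$.
   Context: Permutations in $S_\infty$ compose as functions, $s_i$ is the transposition of $i,i+1$, $\ell(w)$ the length. For $m\geq1$, $w^m$ is the increasing ordering of $w(1),\dots,w(m)$; $A_m(w)$ is the set of strictly increasing sequences $\alpha$ of $m$ positive integers with $\alpha_j\leq w^m_j$ for all $j$ (identified with sets); $\alpha\leq\gamma$ means entrywise $\leq$. $s_i\alpha$ is the increasing sequence with entry set $\{s_i(\alpha_j)\}$; $A_{m,i}(w)=\{\alpha\in A_m(w):s_i\alpha\notin A_m(w)\}$. A multi-set with multiplicities at most 2 is $\eta=\eta_1+2\eta_2$; $x^\alpha=\prod_jx_{\alpha_j}$, $x^\eta=\prod_{j\in\eta_1}x_j\prod_{j\in\eta_2}x_j^2$; $\alpha+\beta$ is multi-set union. $T_m=t_1\cdots t_m$; $\pi_if=(x_if-x_{i+1}s_if)/(x_i-x_{i+1})$. For $\ell(s_iw)>\ell(w)$,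 $N_{w,i}=\prod_{m}\prod_{\alpha\in A_{m,i}(w)}(1-x^{s_i\alpha}T_m)$; $P_{\mathrm{Id}}=1$, $P_{s_iw}=\pi_i(P_wN_{w,i})$ when $\ell(s_iw)>\ell(w)$ (well defined); $m^{k,l}_\eta(w)$ is minus the coefficient of $x^\eta T_kT_l$ in $P_w$. $B_{k,l}(w)$ is the set of $\eta$ with $\eta=\alpha+\beta=\tilde\alpha+\tilde\beta$ for some $\alpha,\tilde\alpha\in A_l(w)$, $\beta,\tilde\beta\in A_k(w)$ with $\alpha\neq\tilde\alpha,\alpha\neq\tilde\beta,\beta\neq\tilde\alpha,\beta\neq\tilde\beta$. $A^\eta_m(w)=\{\alpha\in A_m(w):\eta_2\subseteq\alpha\subseteq\eta_1\cup\eta_2\}$, which (when non-empty) has a unique element $\geq$ all its others; $\alpha_{\max}$ is this element for $A_l^\eta(w)$, $\beta_{\max}$ that for $A_k^\eta(w)$, and $\beta_{\min}$ is the set with $\alpha_{\max}+\beta_{\min}=\eta$. (For $\eta\in B_{k,l}(w)$ with these cardinalities, $\beta_{\min}$ and $\beta_{\max}$ each consist of $\eta_2$ and two elements of $\eta_1$.) *)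

(* Defs.v *)
From HB Require Import structures.
From mathcomp Require Import all_boot all_order all_algebra.
From mathcomp Require Import finmap multiset.
From mathcomp Require Import monalg.
From mathcomp Require Import zify.

Set Implicit Arguments.
Unset Strict Implicit.
Unset Printing Implicit Defensive.

Import Order.TTheory GRing.Theory Num.Theory.

Local Open Scope fset_scope.
Local Open Scope nat_scope.

(* Permutations of the positive integers are finitely supported functions on
   nat that fix 0. *)
Notation perm_nat := {fsfun nat -> nat for id}.

Definition Sinfty : pred perm_nat := [pred w | fsinjectiveb w & w 0 == 0].

Definition s_ (i : nat) : perm_nat :=
  [fsfun j in [fset i; i.+1] => if j == i then i.+1 else i].

Definition bound (w : perm_nat) : nat := \max_(j <- finsupp w) j.

(* Number of inversions; every inversion (p, q) has p < q <= bound w, see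
   inversion_le_bound below. *)
Definition len (w : perm_nat) : nat :=
  \sum_(q < (bound w).+1) \sum_(p < q) (w q < w p).

(* The increasing sequence whose entry set is alpha. *)
Definition incr (alpha : {fset nat}) : seq nat := sort leq (enum_fset alpha).

Definition le_seq (alpha gamma : {fset nat}) : bool :=
  all2 leq (incr alpha) (incr gamma).

Definition wseq (w : perm_nat) (m : nat) : seq nat :=
  sort leq [seq w j | j <- iota 1 m].

(* The powerset only provides finiteness; see in_A. *)
Definition A (m : nat) (w : perm_nat) : {fset {fset nat}} :=
  [fset alpha in fpowerset [fset j in iota 1 (\max_(j <- wseq w m) j)]
    | (#|` alpha| == m) && all2 leq (incr alpha) (wseq w m)].

Definition sact (i : nat) (alpha : {fset nat}) : {fset nat} :=
  [fset s_ i j | j in alpha].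

Definition Ai (m i : nat) (w : perm_nat) : {fset {fset nat}} :=
  [fset alpha in A m w | sact i alpha \notin A m w].

(* The ring Z[x_1, x_2, ..., t_1, t_2, ...]; inl j stands for x_j and inr j
   for t_j. *)
Notation var := (nat + nat)%type.
Notation mon := {cmonom var}.
Notation poly_xt := {malg int[mon]}.

Definition xvar (j : nat) : mon := ucm (inl j : var).
Definition tvar (j : nat) : mon := ucm (inr j : var).

Definition xset (alpha : {fset nat}) : mon :=
  \big[mmul/mone]_(j <- alpha) xvar j.

Definition Tmon (m : nat) : mon := \big[mmul/mone]_(1 <= j < m.+1) tvar j.

Definition svar (i : nat) (v : var) : var :=
  match v with inl j => inl (s_ i j) | inr j => inr j end.

Definition mono (m : mon) : poly_xt := << m >>%R.

(* The substitution exchanging x_i and x_(i+1). *)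
Definition spoly (i : nat) (f : poly_xt) : poly_xt :=
  mmap (@malgC mon int)
    (fun m : mon => \prod_(v <- finsupp m) mono (ucm (svar i v)) ^+ m v)%R f.

(* g = pi_i f, with the denominator cleared; g exists by is_pi_ex and is
   unique since the ring is an integral domain. *)
Definition is_pi (i : nat) (f g : poly_xt) : Prop :=
  ((mono (xvar i) - mono (xvar i.+1)) * g
   = mono (xvar i) * f - mono (xvar i.+1) * spoly i f)%R.

(* The factors with m > maxn i (bound w) are empty products, see Ai_eq0. *)
Definition Npoly (w : perm_nat) (i : nat) : poly_xt :=
  (\prod_(1 <= m < (maxn i (bound w)).+1)
     \prod_(alpha <- Ai m i w) (1 - mono (mmul (xset (sact i alpha)) (Tmon m))))%R.

(* isP w P: P is a value of P_w obtained by the recursion along some chain of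
   length-increasing left multiplications from Id to w. *)
Inductive isP : perm_nat -> poly_xt -> Prop :=
| isP_id : isP [fsfun] 1%R
| isP_s (w : perm_nat) (i : nat) (P Q : poly_xt) :
    isP w P -> 0 < i -> len w < len (fsfun_comp (s_ i) w) ->
    is_pi i (P * Npoly w i)%R Q -> isP (fsfun_comp (s_ i) w) Q.

Notation mset_nat := {mset nat}%mset.

Definition eta1 (eta : mset_nat) : {fset nat} :=
  [fset j in finsupp eta | eta j == 1].
Definition eta2 (eta : mset_nat) : {fset nat} :=
  [fset j in finsupp eta | eta j == 2].

Definition xeta (eta : mset_nat) : mon :=
  mmul (\big[mmul/mone]_(j <- eta1 eta) xvar j)
       (\big[mmul/mone]_(j <- eta2 eta) mmul (xvar j) (xvar j)).

(* m^{k,l}_eta(w), computed from a value P of P_w. *)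
Definition mcoef (k l : nat) (eta : mset_nat) (P : poly_xt) : int :=
  (- P@_(mmul (xeta eta) (mmul (Tmon k) (Tmon l))))%R.

Definition msum (alpha beta : {fset nat}) : mset_nat :=
  (seq_mset (enum_fset alpha) `+` seq_mset (enum_fset beta))%mset.

(* Such an eta has all its multiplicities at most 2. *)
Definition B (k l : nat) (w : perm_nat) (eta : mset_nat) : Prop :=
  exists alpha alpha' beta beta' : {fset nat},
    [/\ alpha \in A l w, alpha' \in A l w, beta \in A k w & beta' \in A k w] /\
    [/\ eta = msum alpha beta, eta = msum alpha' beta' &
     [/\ alpha <> alpha', alpha <> beta', beta <> alpha' & beta <> beta']].

Definition Aeta (m : nat) (eta : mset_nat) (w : perm_nat) : {fset {fset nat}} :=
  [fset alpha in A m w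
    | (eta2 eta `<=` alpha) && (alpha `<=` eta1 eta `|` eta2 eta)].

Definition is_greatest (S : {fset {fset nat}}) (alpha : {fset nat}) : Prop :=
  alpha \in S /\ forall gamma, gamma \in S -> le_seq gamma alpha.

(* The element gamma_j of eta_1 = {gamma_1 < gamma_2 < ...}; indices start
   at 1. *)
Definition gam (eta : mset_nat) (j : nat) : nat := nth 0 (incr (eta1 eta)) j.-1.

Lemma s_E i j :
  s_ i j = if j == i then i.+1 else if j == i.+1 then i else j.
Proof. by rewrite fsfunE !inE; do 2 case: eqP => //. Qed.

Lemma s_K i : involutive (s_ i).
Proof.
move=> j; rewrite !s_E; case: (j =P i) => [->|].
  by rewrite eqxx (gtn_eqF (ltnSn i)).
by move=> /eqP/negPf hj; case: (j =P i.+1) => [->|/eqP/negPf hj']; rewrite ?eqxx ?hj ?hj'.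
Qed.

Lemma wseq_size w m : size (wseq w m) = m.
Proof. by rewrite size_sort size_map size_iota. Qed.

Lemma leq_bound (w : perm_nat) j : bound w < j -> w j = j.
Proof.
move=> h; apply: fsfun_dflt; apply/negP => hj; move: h.
by rewrite ltnNge => /negP; apply; apply: leq_bigmax_seq.
Qed.

Lemma inversion_le_bound (w : perm_nat) p q :
  w \in Sinfty -> p < q -> w q < w p -> q <= bound w.
Proof.
case/andP=> /fsinjectiveP winj _ lt_pq lt_w; rewrite leqNgt; apply/negP => hq.
have wq := leq_bound hq; rewrite wq in lt_w.
have /winj e := leq_bound (ltn_trans hq lt_w).
by move: lt_w; rewrite e ltnNge (ltnW lt_pq).
Qed.

Lemma all2_leq_max (s t : seq nat) (x : nat) :
  all2 leq s t -> x \in s -> exists2 y, y \in t & x <= y.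
Proof.
elim: s t => [|a s IH] [|b t] //= /andP[ab st]; rewrite inE => /orP[/eqP->|xs].
  by exists b; rewrite ?mem_head.
by have [y yt xy] := IH _ st xs; exists y; rewrite // inE yt orbT.
Qed.

Lemma in_A m w alpha :
  (alpha \in A m w)
  = [&& 0 \notin alpha, #|` alpha| == m & all2 leq (incr alpha) (wseq w m)].
Proof.
rewrite !inE /= fpowersetE; apply/andP/and3P.
  move=> [/fsubsetP sub /andP[c a]]; split=> //; apply/negP => /sub.
  by rewrite !inE mem_iota.
move=> [n0 c a]; split; last by rewrite c a.
apply/fsubsetP => j ja; rewrite !inE mem_iota add1n ltnS lt0n.
have -> /= : j != 0 by apply: contraNneq n0 => <-.
have js : j \in incr alpha by rewrite mem_sort.
have [y yt jy] := all2_leq_max a js.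
by apply: leq_trans jy _; exact: leq_bigmax_seq.
Qed.

Lemma wseq_id (w : perm_nat) m :
  w \in Sinfty -> bound w <= m -> wseq w m = iota 1 m.
Proof.
case/andP=> /fsinjectiveP winj /eqP w0 hm.
rewrite /wseq -[RHS](sorted_sort leq_trans (iota_sorted 1 m)).
apply/(perm_sortP leq_total leq_trans anti_leq).
have un : uniq [seq w j | j <- iota 1 m] by rewrite map_inj_uniq ?iota_uniq.
apply: uniq_perm (iota_uniq _ _) _ => //.
have sub : {subset [seq w j | j <- iota 1 m] <= iota 1 m}.
  move=> x /mapP[j]; rewrite !mem_iota !add1n !ltnS => /andP[j0 jm ->].
  rewrite lt0n -w0 (inj_eq winj) -lt0n j0 /= leqNgt; apply/negP => h.
  have /winj e := leq_bound (leq_ltn_trans hm h).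
  by move: h; rewrite e ltnNge jm.
by case: (uniq_min_size un sub); rewrite ?size_map.
Qed.

Lemma Ai_eq0 (w : perm_nat) m i :
  w \in Sinfty -> 0 < i -> maxn i (bound w) < m -> Ai m i w = fset0.
Proof.
move=> hw i0; rewrite gtn_max => /andP[hi hb]; apply/fsetP => alpha.
rewrite /Ai; move: (A m w) (in_A m w) => S inS; rewrite !inE; apply/negbTE/negP => /andP[ha].
case/negP; suff -> : sact i alpha = alpha by [].
move: ha; rewrite inS (wseq_id hw (ltnW hb)) => /and3P[n0 /eqP c le].
have e : alpha = [fset j in iota 1 m].
  apply/eqP; rewrite eqEfcard; apply/andP; split.
    apply/fsubsetP => j ja; rewrite !inE mem_iota add1n ltnS lt0n.
    have -> /= : j != 0 by apply: contraNneq n0 => <-.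
    have js : j \in incr alpha by rewrite mem_sort.
    have [y] := all2_leq_max le js.
    by rewrite mem_iota add1n ltnS => /andP[_ ym] jy; apply: leq_trans jy ym.
  rewrite c card_fseq undup_id ?iota_uniq // size_iota //.
have stab j : (j \in alpha) -> (s_ i j \in alpha).
  rewrite e !inE !mem_iota !add1n !ltnS s_E => /andP[j0 jm].
  case: eqP => [ji|_]; first by rewrite hi.
  case: eqP => [ji|_]; last by rewrite j0 jm.
  by rewrite i0 ltnW.
apply/fsetP => j; apply/imfsetP/idP => [[x /= xa ->]|ja]; first exact: stab.
by exists (s_ i j); rewrite ?s_K ?stab.
Qed.

Lemma monoM m1 m2 : mono (mmul m1 m2) = (mono m1 * mono m2)%R.
Proof. by rewrite /mono malgM_def fgmulUU mulr1. Qed.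

Lemma mono1 : mono mone = 1%R.
Proof. by []. Qed.

Lemma mono_big (I : Type) (r : seq I) (F : I -> mon) :
  mono (\big[mmul/mone]_(v <- r) F v) = (\prod_(v <- r) mono (F v))%R.
Proof. exact: (big_morph mono monoM mono1). Qed.

Lemma mono_iter n m : mono (iter n (mmul m) mone) = (mono m ^+ n)%R.
Proof. by elim: n => [|n IH] //=; rewrite monoM IH exprS. Qed.

Lemma mono_prod (m : mon) :
  mono m = (\prod_(v <- finsupp m) mono (ucm v) ^+ m v)%R.
Proof.
under eq_bigr => v _ do rewrite -mono_iter.
rewrite -mono_big; congr mono; apply/eqP/cmP => u.
have it n v : (iter n (mmul (ucm v)) mone : mon) u = n * (v == u).
  by elim: n => [|n IH] /=; rewrite ?cm1 // cmM IH cmU mulSn.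
rewrite (big_morph (fun x : mon => x u) (id1 := 0) (op1 := addn)); first last.
- exact: cm1.
- by move=> x y; rewrite cmM.
under eq_bigr => v _ do rewrite it.
have [hu|hu] := boolP (u \in finsupp m).
  rewrite (big_fsetD1 u) //= eqxx muln1 big1_fset ?addn0 // => v.
  by rewrite !inE => /andP[/negPf ->]; rewrite muln0.
rewrite big1_fset ?fsfun_dflt // => v hv _.
by case: eqP hu => [<-|_ _]; rewrite ?hv ?muln0.
Qed.

Lemma mulrBB (R : comNzRingType) (a b c e : R) :
  (a * c - b * e = a * (c - e) + e * (a - b))%R.
Proof. by rewrite !mulrBr [(e * a)%R]mulrC [(e * b)%R]mulrC addrA subrK. Qed.

Lemma mulr_pi (R : comNzRingType) (a b c e : R) :
  ((a - b) * c + b * (c - e) = a * c - b * e)%R.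
Proof. by rewrite mulrBl mulrBr addrA subrK. Qed.

Lemma is_pi_ex i f : exists g, is_pi i f g.
Proof.
pose d := (mono (xvar i) - mono (xvar i.+1))%R.
pose dv (a : poly_xt) := exists g, (d * g = a)%R.
have dv0 : dv 0%R by exists 0%R; rewrite mulr0.
have dvD a b : dv a -> dv b -> dv (a + b)%R.
  by move=> [g <-] [h <-]; exists (g + h)%R; rewrite mulrDr.
have dvM a b : dv a -> dv (b * a)%R.
  by move=> [g <-]; exists (b * g)%R; rewrite mulrCA.
have dvMM (a b c e : poly_xt) : dv (a - b)%R -> dv (c - e)%R -> dv (a * c - b * e)%R.
  move=> h1 h2; rewrite mulrBB; apply: dvD; exact: dvM.
have dvP (I : Type) (r : seq I) (F G : I -> poly_xt) :
  (forall v, dv (F v - G v)%R) -> dv (\prod_(v <- r) F v - \prod_(v <- r) G v)%R.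
  move=> h; elim: r => [|v r IH]; first by rewrite !big_nil subrr.
  by rewrite !big_cons; apply: dvMM.
have dvX n (a b : poly_xt) : dv (a - b)%R -> dv (a ^+ n - b ^+ n)%R.
  move=> h; elim: n => [|n IH]; first by rewrite subrr.
  by rewrite !exprS; apply: dvMM.
have dvV v : dv (mono (ucm v) - mono (ucm (svar i v)))%R.
  case: v => j /=; last by rewrite subrr.
  rewrite s_E; case: eqP => [->|_]; first by exists 1%R; rewrite mulr1.
  case: eqP => [->|_]; last by rewrite subrr.
  by exists (-1)%R; rewrite mulrN mulr1 opprB.
have [g hg] : dv (f - spoly i f)%R.
  rewrite [X in (X - _)%R](monalgE f) /spoly mmapE -sumrB.
  apply: (big_ind dv) => // m _.
  have -> : << f@_m *g m >>%R = ((f@_m)%:MP * mono m)%R :> poly_xt.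
    by rewrite /mono malgM_def fgmulUU mulr1 mul1m.
  rewrite -mulrBr; apply: dvM; rewrite [X in (X - _)%R]mono_prod; apply: dvP => v.
  exact: dvX.
exists (f + mono (xvar i.+1) * g)%R; rewrite /is_pi -/d mulrDr mulrCA hg.
exact: mulr_pi.
Qed.

Lemma len_widen (w : perm_nat) N :
  w \in Sinfty -> bound w < N -> len w = \sum_(q < N) \sum_(p < q) (w q < w p).
Proof.
move=> hw hN.
rewrite /len (big_ord_widen N (fun q => \sum_(p < q) (w q < w p))) // big_mkcond.
apply: eq_bigr => q _; case: ifPn => // hq; rewrite big1 // => p _.
apply/eqP; rewrite eqb0; apply: contraNN hq => h.
by rewrite ltnS; apply: (inversion_le_bound hw (ltn_ord p)).
Qed.

Lemma Sinfty_surj (w : perm_nat) v : w \in Sinfty -> exists r, w r = v.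
Proof.
case/andP=> /imfset_eq_fsinjectiveP e _.
have [|hv] := boolP (v \in finsupp w); last by exists v; rewrite fsfun_dflt.
by rewrite -{1}e => /imfsetP[r _ ->]; exists r.
Qed.

Lemma Sinfty_s (w : perm_nat) i :
  w \in Sinfty -> 0 < i -> fsfun_comp (s_ i) w \in Sinfty.
Proof.
move=> /andP[/fsinjectiveP winj /eqP w0] i0; apply/andP; split.
  apply/fsinjectiveP; apply: fscomp_inj => //; exact: (can_inj (s_K i)).
by rewrite fscompE /= w0 s_E (ltn_eqF i0).
Qed.

Lemma adjacent_inversion (w : perm_nat) p q :
  w \in Sinfty -> p < q -> w q < w p ->
  exists i p0 q0, [/\ 0 < i, p0 < q0, w p0 = i.+1 & w q0 = i].
Proof.
move=> hw; have /andP[/fsinjectiveP winj /eqP w0] := hw.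
have [n] := ubnP (w p - w q); elim: n p q => // n IH p q hn hpq hlt.
have [e|ne] := eqVneq (w p) (w q).+1.
  exists (w q), p, q; split => //; rewrite lt0n -w0 (inj_eq winj).
  by rewrite -lt0n (leq_ltn_trans _ hpq).
have lt2 : (w q).+1 < w p by rewrite ltn_neqAle eq_sym ne.
have [r hr] := Sinfty_surj (w q).+1 hw.
have [rq|] := ltnP r q; last rewrite leq_eqVlt => /orP[/eqP rq|qr].
- by exists (w q), r, q; split => //; rewrite lt0n -w0 (inj_eq winj) -lt0n (leq_ltn_trans _ rq).
- by move: hr; rewrite rq => /eqP; rewrite ltn_eqF.
- apply: (IH p r); rewrite ?hr //; last exact: ltn_trans hpq qr.
  by rewrite -ltnS (leq_trans _ hn) // ltnS ltn_sub2l.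
Qed.

Lemma len_s_lt (w : perm_nat) i p0 q0 :
  w \in Sinfty -> 0 < i -> p0 < q0 -> w p0 = i.+1 -> w q0 = i ->
  len (fsfun_comp (s_ i) w) < len w.
Proof.
move=> hw i0 lt0 ep eq; have hu := Sinfty_s hw i0.
have /andP[/fsinjectiveP winj _] := hw.
set u := fsfun_comp _ _ in hu *.
have uE j : u j = s_ i (w j) by rewrite fscompE.
pose N := (maxn q0 (maxn (bound u) (bound w))).+1.
have hN x : x <= maxn q0 (maxn (bound u) (bound w)) -> x < N by [].
rewrite (len_widen hw (N := N)) ?hN ?leq_max ?leqnn ?orbT //.
rewrite (len_widen hu (N := N)) ?hN ?leq_max ?leqnn ?orbT //.
have le p q : p < q -> (u q < u p) <= (w q < w p).
  move=> hpq; rewrite !uE; case: (ltnP (w q) (w p)) => [|h]; first by rewrite leq_b1.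
  rewrite leqn0 eqb0 -leqNgt !s_E.
  have := winj p q0; have := winj q p0; rewrite ep eq => h1 h2.
  have nb : ~ (w p = i /\ w q = i.+1).
    by move=> [/h2 e1 /h1 e2]; move: hpq; rewrite e1 e2 ltnNge (ltnW lt0).
  by do !case: eqP; lia.
have hq0 : q0 < N by rewrite hN // leq_max leqnn.
rewrite (bigD1 (Ordinal hq0)) //= [X in _ < X](bigD1 (Ordinal hq0)) //=.
rewrite -addSn leq_add //; last by do 2 (apply: leq_sum => ? _); exact: le.
rewrite (bigD1 (Ordinal lt0)) //= [X in _ < X](bigD1 (Ordinal lt0)) //=.
rewrite -addSn leq_add //; last by apply: leq_sum => ? _; exact: le.
by rewrite !uE ep eq !s_E; do !case: eqP; lia.
Qed.

Lemma no_inversion_id (w : perm_nat) :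
  w \in Sinfty -> (forall p q, p < q -> w p <= w q) -> w = [fsfun].
Proof.
move=> /andP[/fsinjectiveP winj /eqP w0] h; apply/fsfunP => p; rewrite fsfun0E.
have lt x y : x < y -> w x < w y.
  by move=> xy; rewrite ltn_neqAle h // andbT (inj_eq winj) ltn_eqF.
have ge (k x : nat) : w x + k <= w (x + k).
  elim: k => [|k IH]; first by rewrite !addn0.
  by rewrite !addnS (leq_ltn_trans IH) // lt.
apply/eqP; rewrite eqn_leq; apply/andP; split; last by have := ge p 0; rewrite w0.
have hp : bound w < p + (bound w).+1 by rewrite addnS ltnS leq_addl.
by have := ge (bound w).+1 p; rewrite (leq_bound hp) leq_add2r.
Qed.

Lemma isP_ex (w : perm_nat) : w \in Sinfty -> exists P, isP w P.
Proof.
have [n] := ubnP (len w); elim: n w => // n IH w hn hw.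
pose inv (x : 'I_(bound w).+1 * 'I_(bound w).+1) := (x.1 < x.2) && (w x.2 < w x.1).
have [[p q] /andP[/= hpq hlt]|none] := pickP inv.
  have [i [p0 [q0 [i0 lt0 ep eq]]]] := adjacent_inversion hw hpq hlt.
  have lt := len_s_lt hw i0 lt0 ep eq.
  have [P hP] := IH _ (leq_trans lt hn) (Sinfty_s hw i0).
  have [Q hQ] := is_pi_ex i (P * Npoly (fsfun_comp (s_ i) w) i)%R.
  have e : fsfun_comp (s_ i) (fsfun_comp (s_ i) w) = w.
    by apply/fsfunP => j; rewrite !fscompE /= fscompE /= s_K.
  exists Q; rewrite -[w]e; apply: isP_s hP i0 _ hQ.
  by rewrite e.
suff -> : w = [fsfun] by exists 1%R; exact: isP_id.
apply: no_inversion_id => // p q hpq; rewrite leqNgt; apply/negP => hlt.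
have hq := inversion_le_bound hw hpq hlt.
have hp := leq_trans (ltnW hpq) hq.
have := none (Ordinal (n := (bound w).+1) hp, Ordinal (n := (bound w).+1) hq).
by rewrite /inv /= hpq hlt.
Qed.

(* Main.v *)
Require Import Defs.
From HB Require Import structures.
From mathcomp Require Import all_boot all_order all_algebra.
From mathcomp Require Import finmap multiset monalg.
From mathcomp Require Import zify ring.

Set Implicit Arguments.
Unset Strict Implicit.
Unset Printing Implicit Defensive.

Import Order.TTheory GRing.Theory Num.Theory.

Local Open Scope fset_scope.
Local Open Scope nat_scope.

(* For fixed [k < l] let [p] be the [T_k T_l]-part of [P_w] and
   [S_m = \sum_(alpha in A_m(w)) x^alpha T_m].  Modulo the other T-monomials
   [N_(w,i)] is [(1 - N_k) (1 - N_l)], where [pi_i N_m = 0] and [S_m + N_m] is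
   the [s_i]-invariant sum [S_m] of [s_i w]; hence [E_w = p + S_k S_l] satisfies
   [E_(s_i w) = pi_i E_w], i.e. it is the Demazure character of weight
   [omega_k + omega_l].  Its coefficient at [x^eta] counts the ways to
   distribute [eta_1] over two columns [beta], [alpha] of sizes [k], [l] such
   that [beta] is in [A_k(w)] and the right key of the two-column tableau is in
   [A_l(w)]; this is proved by following the exponents of [x_i], [x_(i+1)].
   The right key is given by parenthesis matching.  The coefficient of [S_k S_l]
   counts the same distributions without matching, so [m^(k,l)_eta(w)] is the
   difference of two counts.  When [beta] has two elements [p < q] outside
   [eta_2], matching moves the positions to [p - 1, q - 1], or to [p - 2, p - 1]
   when [q = p + 1], and both counts are over integer points of intervals. *)

(** * Parenthesis matching of bit words *)

(** [pi_i] mixes the coefficients at different [eta], so the induction along [w] cannot follow a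
    single multi-set: it carries the coefficients of [E_w] at all monomials of T-degree [T_k T_l].
    It closes because [i] precedes [i.+1] in [w] when [s_i] raises the length. Then [A_m(s_i w)] is
    [A_m(w)] together with its images under [s_i], and one step only has to compare the nine pairs
    of exponents of [x_i] and [x_(i+1)] that are at most 2. Tableaux and their keys enter only
    through [pending] and [matched].

    The order on sets is handled by counting the entries up to each threshold. Counts are additive,
    so the common part [eta_2] cancels, and complements in [eta_1] reverse the order: lying below
    [alpha_max] becomes a condition of lying above [beta_min]. Both columns are thus described by
    the two elements of [eta_1] in the short one. *)

Fixpoint bitsum n (F : bitseq -> nat) : nat :=
  if n is n'.+1 then
    bitsum n' (fun s => F (false :: s)) + bitsum n' (fun s => F (true :: s))
  else F [::].

Lemma eq_bitsum n (F G : bitseq -> nat) :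
  (forall s, size s = n -> F s = G s) -> bitsum n F = bitsum n G.
Proof.
elim: n F G => [|n IH] F G h /=; first exact: h.
by congr (_ + _); apply: IH => s hs; apply: h; rewrite /= hs.
Qed.

Lemma bitsumD n (F G : bitseq -> nat) :
  bitsum n (fun s => F s + G s) = bitsum n F + bitsum n G.
Proof. by elim: n F G => [|n IH] F G //=; rewrite !IH addnACA. Qed.

Lemma bitsum_cat m n (F : bitseq -> nat) :
  bitsum (m + n) F = bitsum m (fun s => bitsum n (fun t => F (s ++ t))).
Proof. by elim: m F => [|m IH] F //=; rewrite !IH. Qed.

Lemma bitsum0 n (F : bitseq -> nat) :
  (forall s, size s = n -> F s = 0) -> bitsum n F = 0.
Proof.
move=> h; rewrite (@eq_bitsum n F (fun=> 0)) //.
by elim: n {h} => //= n ->.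
Qed.

(* A word is read from right to left, each [true] opening a parenthesis that is
   closed by the next free [false]; h parentheses are open at the start. *)
Fixpoint pending (h : nat) (s : bitseq) : nat :=
  if s is b :: s' then
    if b then (pending h s').+1 else (pending h s').-1
  else h.

(** When [s] marks the short column, the letters found here are those that the column exchange
    behind the right key removes from the long column. *)
Fixpoint matched (h : nat) (s : bitseq) : bitseq :=
  if s is b :: s' then (~~ b && (0 < pending h s')) :: matched h s' else [::].

Lemma size_matched h s : size (matched h s) = size s.
Proof. by elim: s => //= b s ->. Qed.

Lemma pending_cat h s t : pending h (s ++ t) = pending (pending h t) s.
Proof. by elim: s => //= b s ->. Qed.

Lemma matched_cat h s t :
  matched h (s ++ t) = matched (pending h t) s ++ matched h t.
Proof. by elim: s => //= b s ->; rewrite pending_cat. Qed.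

(** Every parenthesis is either closed or still pending. So with nothing pending the matched letters
    are as many as the letters [true], which gives the long key column its correct size. *)
Lemma count_matched h s :
  pending h s + count id (matched h s) = h + count id s.
Proof.
elim: s => //= b s IH; case: b => /=; first by rewrite add0n addSn IH addnCA.
by case: (pending h s) IH => [|x] //= <-; rewrite add1n addSn addnS.
Qed.

Lemma pending0_nseq n : pending 0 (nseq n false) = 0.
Proof. by elim: n => //= n ->. Qed.

Lemma matched0_nseq n : matched 0 (nseq n false) = nseq n false.
Proof. by elim: n => //= n ->; rewrite pending0_nseq. Qed.

(** A matched letter has a [true] to its right, and that letter of the increasing list [g] is
    larger. This serves the identity permutation, where it bounds the matched letters by [k]. *)
Lemma mask_matched_le g s K :
  sorted ltn g -> size s = size g -> all (leq^~ K) (mask s g) ->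
  all (leq^~ K) (mask (matched 0 s) g).
Proof.
elim: s g => [|b s IH] [|x g] //= hp [hs].
have hg := path_sorted hp; have hx := order_path_min ltn_trans hp.
case: b => /= [/andP[_]|] h; first exact: IH.
case: ifP => [hpend /=|_]; last exact: IH.
rewrite IH // andbT.
have : has id s.
  rewrite has_count; have := count_matched 0 s; rewrite add0n => <-.
  by rewrite addn_gt0 hpend.
move=> hs1; have [y yin] : exists y, y \in mask s g.
  have : 0 < size (mask s g) by rewrite size_mask // -has_count.
  by case: (mask s g) => // y r _; exists y; rewrite mem_head.
apply: leq_trans (allP h _ yin); apply: ltnW.
by move/allP: hx; apply; apply: mem_mask yin.
Qed.

(** * Words with one or two letters [true] *)

Definition oneword n q : bitseq := mkseq (eq_op q) n.

Definition pairword n p q : bitseq := mkseq (fun j => (j == p) || (j == q)) n.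

Lemma mkseqS (T : Type) (f : nat -> T) n :
  mkseq f n.+1 = f 0 :: mkseq (fun j => f j.+1) n.
Proof. by rewrite /mkseq /= -(addn0 1) iotaDl -map_comp. Qed.

Lemma mkseq_false n : mkseq (fun=> false) n = nseq n false.
Proof. by elim: n => // n IH; rewrite mkseqS IH. Qed.

Lemma oneword0 n : oneword n.+1 0 = true :: nseq n false.
Proof. by rewrite /oneword mkseqS mkseq_false. Qed.

Lemma onewordS n q : oneword n.+1 q.+1 = false :: oneword n q.
Proof. by rewrite /oneword mkseqS. Qed.

Lemma pairword0 n q : pairword n.+1 0 q.+1 = true :: oneword n q.
Proof.
by rewrite /pairword mkseqS; congr (_ :: _); apply: eq_mkseq => j /=; rewrite eq_sym.
Qed.

Lemma pairwordS n p q : pairword n.+1 p.+1 q.+1 = false :: pairword n p q.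
Proof. by rewrite /pairword mkseqS. Qed.

Lemma bitsum_count0 n (F : bitseq -> nat) :
  (forall s, count id s != 0 -> F s = 0) -> bitsum n F = F (nseq n false).
Proof.
elim: n F => //= n IH F h; rewrite (IH (fun s => F (false :: s))) => [|s hs]; last exact: h.
by rewrite bitsum0 ?addn0 // => s _; exact: h.
Qed.

Lemma bitsum_count1 n (F : bitseq -> nat) :
  (forall s, count id s != 1 -> F s = 0) ->
  bitsum n F = \sum_(q < n) F (oneword n q).
Proof.
elim: n F => [|n IH] F h /=; first by rewrite big_ord0 h.
rewrite big_ord_recl oneword0 (@bitsum_count0 n (fun s => F (true :: s))) => [|s hs]; last first.
  by apply: h; rewrite /= eqSS.
rewrite (IH (fun s => F (false :: s))) => [|s hs]; last exact: h.
by rewrite addnC; congr (_ + _); apply: eq_bigr => q _; rewrite onewordS.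
Qed.

Lemma bitsum_count2 n (F : bitseq -> nat) :
  (forall s, count id s != 2 -> F s = 0) ->
  bitsum n F = \sum_(q < n) \sum_(p < q) F (pairword n p q).
Proof.
elim: n F => [|n IH] F h /=; first by rewrite big_ord0 h.
rewrite big_ord_recl big_ord0 add0n.
rewrite (@bitsum_count1 n (fun s => F (true :: s))) => [|s hs]; last by apply: h; rewrite /= eqSS.
rewrite (IH (fun s => F (false :: s))) => [|s hs]; last exact: h.
rewrite addnC -big_split; apply: eq_bigr => q _ /=.
rewrite big_ord_recl /= pairword0; congr (_ + _).
by apply: eq_bigr => p _; rewrite -pairwordS.
Qed.

Lemma pending_oneword n q : q < n -> pending 0 (oneword n q) = (q == 0).
Proof.
elim: n q => // n IH [|q] hq; first by rewrite oneword0 /= pending0_nseq.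
by rewrite onewordS /= IH //; case: q {hq}.
Qed.

Lemma matched_oneword n q : q < n ->
  matched 0 (oneword n q) = if q is q'.+1 then oneword n q' else nseq n false.
Proof.
elim: n q => // n IH [|q] hq; first by rewrite oneword0 /= matched0_nseq.
rewrite onewordS /= pending_oneword // IH //.
by case: q hq => [|q] _; rewrite /= ?oneword0 ?onewordS.
Qed.

(** Read from the right, [q] is closed by [q - 1] unless that position is [p]; in that case [p]
    opens on top of [q] and is closed first. Only [p <= 1] can leave too few [false] letters on the
    left. *)
Lemma pending_pairword n p q : p < q < n ->
  pending 0 (pairword n p q) =
  match p with 0 => (q == 1).+1 | 1 => q == 2 | _ => 0 end.
Proof.
elim: n p q => [|n IH] [|p] [|q]; rewrite ?ltn0 ?andbF // !ltnS => hq.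
  by rewrite pairword0 /= pending_oneword.
rewrite pairwordS /= IH //.
by case: p q hq => [|[|p]] [|[|q]] //=; case: q.
Qed.

(** Letters that are not adjacent are closed independently, by [p - 1] and [q - 1]. Adjacent ones
    are nested: [p - 1] closes [p] and [p - 2] closes [q]. The last branch is a filler, excluded by
    [p < q]. *)
Lemma matched_pairword n p q : p < q < n ->
  matched 0 (pairword n p q) =
  match p, q with
  | 0, 1 => nseq n false
  | 0, q'.+1 => oneword n q'
  | 1, 2 => oneword n 0
  | p'.+1, q'.+1 => if q == p.+1 then pairword n p'.-1 p' else pairword n p' q'
  | _, 0 => [::]
  end.
Proof.
elim: n p q => [|n IH] [|p] [|q]; rewrite ?ltn0 ?andbF // !ltnS => hq.
  rewrite pairword0 /= matched_oneword //; case: q hq => [|q] hq //.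
  by rewrite onewordS.
rewrite pairwordS /= pending_pairword // IH //.
case: p hq => [|[|p]]; case: q => [|[|q]] // hq.
- by rewrite oneword0.
- by rewrite pairword0.
- case: q hq => [|q] hq /=; first by rewrite pairword0.
  by rewrite pairwordS.
- have -> : (q.+3 == p.+4) = (q.+2 == p.+3) by [].
  by case: ifP => _; rewrite pairwordS.
Qed.

(** * Counting the pairs of positions *)

Lemma sum_interval q x y : \sum_(p < q) (x <= p <= y) = minn q y.+1 - x.
Proof.
elim: q => [|q IH]; first by rewrite big_ord0 min0n.
by rewrite big_ord_recr /= IH; case: (x <= q <= y) / andP; lia.
Qed.

Lemma mask_pairword (g : seq nat) p q :
  p < q < size g -> mask (pairword (size g) p q) g = [:: nth 0 g p; nth 0 g q].
Proof.
have mask0 (r : seq nat) : mask (nseq (size r) false) r = [::] by elim: r.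
have mask1 (r : seq nat) j : j < size r -> mask (oneword (size r) j) r = [:: nth 0 r j].
  elim: r j => [|x r IH] [|j] // hj; change (size (x :: r)) with (size r).+1.
    by rewrite oneword0 /= mask0.
  by rewrite onewordS /= IH.
elim: g p q => [|x r IH] [|p] [|q]; rewrite ?ltn0 ?andbF // => hq;
  change (size (x :: r)) with (size r).+1.
  by rewrite pairword0 /= mask1.
by rewrite pairwordS /= IH.
Qed.

(** Positions count from 0. The bounds by [c] and [d] express that the short column is at most
    [beta_max]; the others express that the closing positions, [(p - 1, q - 1)] or [(p - 2, p - 1)],
    are at least [(a, b)], the positions missing from [alpha_max]. Being strict, they also ensure
    that both parentheses get closed. *)
Definition standard_pair a b c d p q : bool :=
  [&& p <= c, q <= d &
    if q == p.+1 then (a.+1 < p) && (b < p) else (a < p) && (b < q)].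

Lemma leq_nth_sorted (g : seq nat) x y : sorted ltn g -> x < size g -> y < size g ->
  (nth 0 g x <= nth 0 g y) = (x <= y).
Proof.
move=> gs hx hy; have h := sorted_ltn_nth ltn_trans 0 gs.
case: (ltngtP x y) => [lt|gt|->]; last by rewrite leqnn.
  by apply/ltnW/h.
by apply/negbTE; rewrite -ltnNge; apply: h.
Qed.

Lemma standard_pairE (g : seq nat) a b c d p q :
  sorted ltn g -> a < b < size g -> c < d < size g -> p < q < size g ->
  [&& pending 0 (pairword (size g) p q) == 0,
      all2 leq (mask (pairword (size g) p q) g) [:: nth 0 g c; nth 0 g d] &
      all2 leq [:: nth 0 g a; nth 0 g b]
        (mask (matched 0 (pairword (size g) p q)) g)]
  = standard_pair a b c d p q.
Proof.
move=> gs hab hcd hpq.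
have nthE x y := @leq_nth_sorted g x y gs.
have mask0 : mask (nseq (size g) false) g = [::].
  by elim: (g) => //= x r ->.
rewrite mask_pairword // pending_pairword // matched_pairword //= /standard_pair.
rewrite !nthE ?andbT; try lia.
have maskE := fun p q h => (@mask_pairword g p q h).
case: p hpq => [|[|p]] hpq.
- symmetry; apply/negbTE/negP => /and3P[_ _].
  by case: ifP => _ /andP[]; rewrite ltn0.
- case: q hpq => [|[|[|q]]] hpq //=; first by lia.
  rewrite maskE; last by lia.
  rewrite /= !nthE ?andbT; lia.
- rewrite /=; case: q hpq => [|q] hpq; first by lia.
  by rewrite eqSS; case: eqP => [e|ne]; rewrite maskE /= ?nthE ?andbT; lia.
Qed.

(** The correction term is the multiplicity sought. It involves only differences of indices, so
    counting from 0 instead of 1 does no harm, and its two branches agree at [b = c]. *)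
Lemma standard_pair_sum n a b c d :
  a < b -> c < d < n -> a <= c -> b <= d ->
  \sum_(q < n) \sum_(p < q) [&& a <= p <= c & b <= q <= d]
  = \sum_(q < n) \sum_(p < q) standard_pair a b c d p q
    + (if b <= c then (d - a).+1 else (d - b + (c - a)).+1).
Proof.
move=> hab /andP[hcd hdn] hac hbd.
have inner1 q : \sum_(p < q) [&& a <= p <= c & b <= q <= d]
    = if b <= q <= d then minn q c.+1 - a else 0.
  case: ifP => _; last by rewrite big1 // => p _; rewrite andbF.
  by rewrite -sum_interval; apply: eq_bigr => p _; rewrite andbT.
(* The last summand is the adjacent pair [p = q], the only one in row [q.+1] with the nested closing
   rule. *)
have inner2 q : \sum_(p < q.+1) standard_pair a b c d p q.+1
    = (if b <= q < d then minn q c.+1 - a.+1 else 0)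
      + [&& q <= c, q < d, a.+1 < q & b < q].
  rewrite big_ord_recr /= /standard_pair eqxx; congr (_ + _).
  case: ifP => h; last first.
    rewrite big1 // => p _; rewrite eqSS gtn_eqF ?ltn_ord //.
    by apply/eqP; rewrite eqb0; apply: contraFN h => /and3P[_ ? /andP[]]; lia.
  rewrite -sum_interval; apply: eq_bigr => p _; rewrite eqSS gtn_eqF ?ltn_ord //.
  by move: h; lia.
under eq_bigr do rewrite inner1.
(* The excess of all pairs over the standard ones in the rows up to [m]. Row [b] contributes
   [minn c b.-1 + 1 - a], as it contains no standard pair. Each later row contributes one, and row
   [b.+1] one more if [b <= c], because its adjacent pair [(b, b.+1)] fails to be standard. *)
have main m : m <= d ->
  \sum_(q < m.+1) (if b <= q <= d then minn q c.+1 - a else 0)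
  = \sum_(q < m.+1) \sum_(p < q) standard_pair a b c d p q
    + (if b <= m then minn c b.-1 + 1 - a + (m - b) + ((b < m) && (b <= c)) else 0).
  elim: m => [|m IH] hm; first by rewrite !big_ord1 big_ord0 /= leqNgt (leq_ltn_trans _ hab).
  rewrite big_ord_recr IH ?(ltnW hm) //= [X in _ = X + _]big_ord_recr /= inner2.
  move: (\sum_(i < m.+1) _) => S; rewrite hm !ltnS !andbT.
  case: (ltngtP b m.+1) => h1; case: (ltngtP b m) => h2; case: (leqP m c) => h3;
    case: (leqP b c) => h4; case: (ltnP a.+1 m) => h5 //=; lia.
have tail (F : nat -> nat) : (forall q, d < q -> F q = 0) ->
    \sum_(q < n) F q = \sum_(q < d.+1) F q.
  move=> h; rewrite -!(big_mkord xpredT F) (big_cat_nat _ (n := d.+1)) //=.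
  by rewrite [X in _ + X]big1_seq ?addn0 // => q /andP[_]; rewrite mem_index_iota => /andP[/h].
rewrite (tail (fun q => if b <= q <= d then minn q c.+1 - a else 0)) => [|q hq]; last first.
  by rewrite (leqNgt q) hq andbF.
rewrite (tail (fun q => \sum_(p < q) standard_pair a b c d p q)) => [|q hq]; last first.
  by rewrite big1 // => p _; rewrite /standard_pair (leqNgt q) hq andbF.
rewrite main // hbd; congr (_ + _).
by case: (leqP b c) => h; case: (ltnP b d) => h' /=; lia.
Qed.

(** * Membership in A_m(w) by counting *)

(** Counting functions are additive under concatenation and insensitive to the order of a list, so
    neither sorting nor indices are needed afterwards. *)
Lemma all2_leq_countP (s t : seq nat) :
  sorted leq s -> sorted leq t -> size s = size t ->
  reflect (forall j, count (leq^~ j) t <= count (leq^~ j) s) (all2 leq s t).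
Proof.
move=> hs ht e; apply: (iffP idP).
  elim: s t {hs ht e} => [|x s IH] [|y t] //= /andP[xy /IH h] j.
  by apply: leq_add (h j); case: (leqP y j) => // yj; rewrite (leq_trans xy yj).
elim: s t hs ht e => [|x s IH] [|y t] //= hs ht [e] h.
have hx := order_path_min leq_trans hs; have hy := order_path_min leq_trans ht.
have xy : x <= y.
  have : has (leq^~ y) (x :: s) by rewrite has_count (leq_trans _ (h y)) //= leqnn.
  by case/orP => // /hasP[z zs]; apply: leq_trans; exact: (allP hx).
rewrite xy; apply: IH (path_sorted hs) (path_sorted ht) e _ => j.
have := h j; case: (leqP y j) => yj; first by rewrite (leq_trans xy yj) leq_add2l.
move=> _; rewrite (@eq_in_count _ _ pred0) ?count_pred0 // => z zt /=.
by rewrite leqNgt (leq_trans yj) // (allP hy).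
Qed.

(** Membership in [A m w] for unsorted lists such as a mask followed by [r]. That the list has no
    duplicates is presupposed, not tested. *)
Definition fits (m : nat) (w : perm_nat) (r : seq nat) : bool :=
  [&& 0 \notin r, size r == m & all2 leq (sort leq r) (wseq w m)].

Lemma in_A_fits m w (alpha : {fset nat}) :
  (alpha \in A m w) = fits m w (enum_fset alpha).
Proof. by rewrite in_A. Qed.

Lemma perm_fits m w r1 r2 : perm_eq r1 r2 -> fits m w r1 = fits m w r2.
Proof.
move=> h; rewrite /fits (perm_mem h) (perm_size h).
by have /(perm_sortP leq_total leq_trans anti_leq) -> := h.
Qed.

Lemma fitsP m (w : perm_nat) (r : seq nat) :
  reflect [/\ 0 \notin r, size r = m &
            forall j, count (leq^~ j) [seq w p | p <- iota 1 m] <= count (leq^~ j) r]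
    (fits m w r).
Proof.
have [e|e] := eqVneq (size r) m; last first.
  by apply: (iffP idP) => [/and3P[_ /eqP h _]|[_ h _]]; rewrite h eqxx in e.
 have P := all2_leq_countP (sort_sorted leq_total r)
  (sort_sorted leq_total [seq w p | p <- iota 1 m]).
rewrite /fits e eqxx /=; apply: (iffP andP) => [[h0 h]|[h0 _ h]]; split => //.
  move=> j; have := elimT (P _) h j; rewrite !size_sort size_map size_iota.
  by rewrite !(permP (permEl (perm_sort _ _))); apply.
apply/P; first by rewrite !size_sort size_map size_iota.
by move=> j; rewrite !(permP (permEl (perm_sort _ _))).
Qed.

Lemma count_leqS j (r : seq nat) :
  count (leq^~ j.+1) r = count (leq^~ j) r + count_mem j.+1 r.
Proof.
elim: r => //= x r ->; rewrite addnACA; congr (_ + _).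
by rewrite (leq_eqVlt x) ltnS; case: eqP => [->|]; rewrite ?ltnn ?addn0.
Qed.

Lemma fits_lower m (v : perm_nat) i (r : seq nat) : 0 < i ->
  fits m v (i.+1 :: r) -> fits m v (i :: r).
Proof.
move=> i0 /fitsP[h0 hs h]; apply/fitsP; split => //.
  by move: h0; rewrite !inE; lia.
by move=> j; have := h j => /=; lia.
Qed.

Section Adjacent.

Variables (w : perm_nat) (i : nat).
Hypotheses (hw : w \in Sinfty) (i0 : 0 < i).
Hypothesis hlen : len w < len (fsfun_comp (s_ i) w).

Local Notation u := (fsfun_comp (s_ i) w).
Local Notation W v m j := (count (leq^~ j) [seq v p | p <- iota 1 m]).

Lemma count_values_s m j : j != i -> W u m j = W w m j.
Proof.
move=> ji; rewrite !count_map; apply: eq_count => p /=; rewrite fscompE /= s_E.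
by case: eqP => [->|_]; last case: eqP => [->|_] //; lia.
Qed.

(** [e1] and [e2] tell whether the values [i] and [i.+1] occur among the first [m]. Since [s_i]
    raises the length, [i] stands to the left of [i.+1] in [w], whence [e2 <= e1]. Only the count at
    threshold [i] changes from [w] to [u]. *)
Lemma values_s m : exists e1 e2 : bool,
  [/\ e2 <= e1, W w m i = W w m i.-1 + e1,
      W w m i.+1 = W w m i + e2 & W u m i = W w m i.-1 + e2].
Proof.
have /andP[/fsinjectiveP winj /eqP w0] := hw.
have un : uniq [seq w p | p <- iota 1 m] by rewrite map_inj_uniq ?iota_uniq.
exists (i \in [seq w p | p <- iota 1 m]), (i.+1 \in [seq w p | p <- iota 1 m]).
rewrite -!(count_uniq_mem _ un) count_leqS; split => //.
- rewrite !(count_uniq_mem _ un).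
  case: mapP => [[q hq eq] |//]; rewrite lt0b.
  have [p ep] := Sinfty_surj i hw.
  apply/mapP; exists p => //; move: hq; rewrite !mem_iota !add1n !ltnS => /andP[q1 qm].
  have pq : p < q.
    case: (ltngtP p q) => // [qp|e]; last by move: ep; rewrite e -eq; lia.
    by have := len_s_lt hw i0 qp (esym eq) ep; rewrite ltnNge (ltnW hlen).
  by rewrite (leq_trans (ltnW pq) qm) andbT lt0n; apply: contraTneq i0 => p0; rewrite -ep p0 w0.
- by case: i i0 => // i' _; rewrite count_leqS.
- have -> : W w m i.-1 = W u m i.-1 by rewrite count_values_s //; lia.
  case: i i0 => // i' _; rewrite count_leqS; congr (_ + _).
  rewrite !count_map; apply: eq_count => p /=; rewrite fscompE /= s_E.
  have [->|ne] := eqVneq (w p) i'.+1; first lia.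
  by have [e|ne'] := eqVneq (w p) i'.+2; rewrite ?eqxx //; apply/negbTE.
Qed.

(** The two conditions differ only at threshold [i]. There the stronger one follows from threshold
    [i.-1] if [r] contains [i], and from threshold [i.+1] if [r] avoids [i.+1]. *)
Lemma fits_s m (r : seq nat) : uniq r -> (i.+1 \in r -> i \in r) -> fits m u r = fits m w r.
Proof.
move=> ur hi; have [e1 [e2 [he E1 E2 E3]]] := values_s m.
have c1 : count (leq^~ i) r = count (leq^~ i.-1) r + (i \in r).
  by case: i i0 => // i' _; rewrite count_leqS count_uniq_mem.
have c2 : count (leq^~ i.+1) r = count (leq^~ i) r + (i.+1 \in r).
  by rewrite count_leqS count_uniq_mem.
have i1 : i.-1 != i by lia.
have i2 : i.+1 != i by lia.
apply/fitsP/fitsP => -[h0 hs h]; split=> // j; have [->|ji] := eqVneq j i;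
  [have := h i.-1; have := h i.+1 | have := h j | have := h i.-1; have := h i.+1 | have := h j];
  rewrite ?(count_values_s _ i1) ?(count_values_s _ i2) ?(count_values_s _ ji);
  move: hi E1 E2 E3 he c1 c2;
  case: e1; case: e2; case: (i \in r); case: (i.+1 \in r) => h';
    first [by have := h' isT |
    move: (W w m i.+1) (W w m i.-1) (W w m i) (W u m i) (W w m j)
      (count (leq^~ i) r) (count (leq^~ i.-1) r) (count (leq^~ i.+1) r)
      (count (leq^~ j) r); clear; intros; lia].
Qed.

(** Together with [fits_s] this reduces every membership for [u] to one for [w]. *)
Lemma fits_s_move m (r : seq nat) : i \notin r -> i.+1 \notin r ->
  fits m u (i.+1 :: r) = fits m w (i :: r).
Proof.
move=> hi hi'; have [e1 [e2 [he E1 E2 E3]]] := values_s m.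
have c1 : count (leq^~ i) r = count (leq^~ i.-1) r.
  by case: i i0 hi => // i' _ hi; rewrite count_leqS (count_memPn hi) addn0.
have c2 : count (leq^~ i.+1) r = count (leq^~ i) r.
  by rewrite count_leqS (count_memPn hi') addn0.
have i1 : i.-1 != i by lia.
have i2 : i.+1 != i by lia.
apply/fitsP/fitsP => -[h0 hs h]; split=> //; try by move: h0; rewrite !inE; lia.
all: move=> j; have [->|ji] := eqVneq j i;
  [ have := h i.-1; have := h i.+1 | have := h j ];
  rewrite ?(count_values_s _ i1) ?(count_values_s _ i2) ?(count_values_s _ ji) /=;
  move: E1 E2 E3 he c1 c2; case: e1; case: e2;
  move: (W w m i.+1) (W w m i.-1) (W w m i) (W u m i) (W w m j)
    (count (leq^~ i) r) (count (leq^~ i.-1) r) (count (leq^~ i.+1) r)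
    (count (leq^~ j) r); first [clear -i0 ji | clear -i0]; intros; lia.
Qed.

End Adjacent.

(** * The recursion of the standard counts *)

(** The word [s] marks the elements of [g], those of multiplicity one, that lie in the short column;
    [r] lies in both columns. That nothing is pending is the row condition of a two-column tableau.
    The right key consists of the short column itself and of [r] with the letters of [g] that are
    not matched. *)
Definition standard_count (k l : nat) (w : perm_nat) (g r : seq nat) : nat :=
  bitsum (size g) (fun s =>
    [&& pending 0 s == 0, fits k w (mask s g ++ r) &
        fits l w (mask (map negb (matched 0 s)) g ++ r)]).

Lemma eq_standard_count k l w w' g g' r r' :
  size g = size g' ->
  (forall m s, size s = size g ->
     fits m w (mask s g ++ r) = fits m w' (mask s g' ++ r')) ->
  standard_count k l w g r = standard_count k l w' g' r'.
Proof.
move=> eg h; rewrite /standard_count -eg; apply: eq_bitsum => s hs.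
by rewrite !h // size_map size_matched.
Qed.

Lemma perm_standard_count k l w g r r' :
  perm_eq r r' -> standard_count k l w g r = standard_count k l w g r'.
Proof.
by move=> h; apply: eq_standard_count => // m s _; apply: perm_fits; rewrite perm_cat2l.
Qed.

Ltac perm_count :=
  apply/permP => ?; rewrite /= ?count_cat /= ?count_cat /=;
  repeat match goal with |- context [count ?P ?s] => move: (count P s) => ? end; lia.

Section Recursion.

Variables (k l : nat) (w : perm_nat) (i : nat).
Hypotheses (hw : w \in Sinfty) (i0 : 0 < i).
Hypothesis hlen : len w < len (fsfun_comp (s_ i) w).

Local Notation u := (fsfun_comp (s_ i) w).
Local Notation std := (standard_count k l).

Lemma fits_shapes m r : uniq [:: i, i.+1 & r] ->
  [/\ fits m u r = fits m w r, fits m u (i :: r) = fits m w (i :: r),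
      fits m u (i.+1 :: r) = fits m w (i :: r)
    & fits m u [:: i, i.+1 & r] = fits m w [:: i, i.+1 & r]].
Proof.
move=> un; have := un; rewrite /= inE negb_or => /and3P[/andP[_ h1] h2 h3].
split; try (apply: fits_s; rewrite ?inE ?eqxx //=).
- by rewrite (negPf h2).
- by rewrite h1.
- exact: fits_s_move.
Qed.

Lemma uniq_mask_cat (p g1 g2 r : seq nat) s1 s2 :
  uniq (p ++ g1 ++ g2 ++ r) -> uniq (p ++ mask s1 g1 ++ mask s2 g2 ++ r).
Proof.
apply: subseq_uniq; rewrite cat_subseq // cat_subseq ?mask_subseq //.
by rewrite cat_subseq // mask_subseq.
Qed.

Section Lists.

Variables (g1 g2 r : seq nat).
Hypothesis hu : uniq [:: i, i.+1 & g1 ++ g2 ++ r].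

Lemma split_word n (s : bitseq) : size s = size g1 + (n + size g2) ->
  exists s1 t s2 : bitseq, [/\ s = s1 ++ t ++ s2, size s1 = size g1, size t = n &
    size s2 = size g2].
Proof.
move=> hs; exists (take (size g1) s), (take n (drop (size g1) s)),
  (drop n (drop (size g1) s)); split; rewrite ?cat_take_drop //.
- by rewrite size_takel // hs leq_addr.
- by rewrite size_takel // size_drop hs addKn leq_addr.
- by rewrite !size_drop hs !addKn.
Qed.

Let shapes s1 s2 m := fits_shapes m (@uniq_mask_cat [:: i; i.+1] g1 g2 r s1 s2 hu).

(** In this and the following names the digits are the exponents of [x_i] and [x_(i+1)] on the side
    of [u]: a letter of exponent 1 stands between [g1] and [g2], one of exponent 2 in front of [r].
    Apart from 11, the words on both sides correspond one to one with the same matching. *)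
Lemma standard_count_00 : std u (g1 ++ g2) r = std w (g1 ++ g2) r.
Proof.
apply: eq_standard_count => // m s; rewrite size_cat => /(@split_word 0).
move=> [s1 [t [s2 [-> h1 /size0nil -> h2]]]]; rewrite cat0s mask_cat // -catA.
by case: (shapes s1 s2 m).
Qed.

Lemma standard_count_22 :
  std u (g1 ++ g2) [:: i, i.+1 & r] = std w (g1 ++ g2) [:: i, i.+1 & r].
Proof.
apply: eq_standard_count => // m s; rewrite size_cat => /(@split_word 0).
move=> [s1 [t [s2 [-> h1 /size0nil -> h2]]]]; rewrite cat0s mask_cat // -catA.
have E := @perm_fits m _ _ [:: i, i.+1 & mask s1 g1 ++ mask s2 g2 ++ r].
by rewrite !E; try perm_count; case: (shapes s1 s2 m).
Qed.

Lemma standard_count_20 : std u (g1 ++ g2) (i :: r) = std w (g1 ++ g2) (i :: r).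
Proof.
apply: eq_standard_count => // m s; rewrite size_cat => /(@split_word 0).
move=> [s1 [t [s2 [-> h1 /size0nil -> h2]]]]; rewrite cat0s mask_cat // -catA.
have E := @perm_fits m _ _ (i :: mask s1 g1 ++ mask s2 g2 ++ r).
by rewrite !E; try perm_count; case: (shapes s1 s2 m).
Qed.

Lemma standard_count_02 : std u (g1 ++ g2) (i.+1 :: r) = std w (g1 ++ g2) (i :: r).
Proof.
apply: eq_standard_count => // m s; rewrite size_cat => /(@split_word 0).
move=> [s1 [t [s2 [-> h1 /size0nil -> h2]]]]; rewrite cat0s mask_cat // -!catA.
rewrite (@perm_fits m u _ (i.+1 :: mask s1 g1 ++ mask s2 g2 ++ r)); last by perm_count.
rewrite (@perm_fits m w _ (i :: mask s1 g1 ++ mask s2 g2 ++ r)); last by perm_count.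
by case: (shapes s1 s2 m).
Qed.

Lemma mask_insert s1 b s2 x (q : seq nat) : size s1 = size g1 ->
  perm_eq (mask (s1 ++ b :: s2) (g1 ++ x :: g2) ++ q)
          (nseq b x ++ mask s1 g1 ++ mask s2 g2 ++ q).
Proof. by move=> h; rewrite mask_cat //=; case: b; perm_count. Qed.

Lemma standard_count_10 : std u (g1 ++ i :: g2) r = std w (g1 ++ i :: g2) r.
Proof.
apply: eq_standard_count => // m s; rewrite size_cat => /(@split_word 1).
move=> [s1 [t [s2 [-> h1 ht h2]]]]; case: t ht => [|b [|? ?]] //= _.
rewrite !(perm_fits _ _ (mask_insert _ _ _ _ h1)).
by case: (shapes s1 s2 m); case: b.
Qed.

Lemma standard_count_01 : std u (g1 ++ i.+1 :: g2) r = std w (g1 ++ i :: g2) r.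
Proof.
apply: eq_standard_count => [|m s]; rewrite size_cat; first by rewrite size_cat.
move=> /(@split_word 1) [s1 [t [s2 [-> h1 ht h2]]]]; case: t ht => [|b [|? ?]] //= _.
rewrite !(perm_fits _ _ (mask_insert _ _ _ _ h1)).
by case: (shapes s1 s2 m); case: b.
Qed.

Lemma standard_count_21 :
  std u (g1 ++ i.+1 :: g2) (i :: r) = std w (g1 ++ i.+1 :: g2) (i :: r).
Proof.
apply: eq_standard_count => // m s; rewrite size_cat => /(@split_word 1).
move=> [s1 [t [s2 [-> h1 ht h2]]]]; case: t ht => [|b [|? ?]] //= _.
rewrite !(perm_fits _ _ (mask_insert _ _ _ _ h1)).
have E v := @perm_fits m v _ (i :: nseq b i.+1 ++ mask s1 g1 ++ mask s2 g2 ++ r).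
by rewrite !E; try perm_count; case: (shapes s1 s2 m); case: (b).
Qed.

Lemma standard_count_12 :
  std u (g1 ++ i :: g2) (i.+1 :: r) = std w (g1 ++ i.+1 :: g2) (i :: r).
Proof.
apply: eq_standard_count => [|m s]; rewrite size_cat; first by rewrite size_cat.
move=> /(@split_word 1) [s1 [t [s2 [-> h1 ht h2]]]]; case: t ht => [|b [|? ?]] //= _.
rewrite !(perm_fits _ _ (mask_insert _ _ _ _ h1)).
rewrite (@perm_fits m u _ (nseq b i ++ i.+1 :: mask s1 g1 ++ mask s2 g2 ++ r)); last first.
  by perm_count.
rewrite (@perm_fits m w _ (i :: nseq b i.+1 ++ mask s1 g1 ++ mask s2 g2 ++ r)); last first.
  by perm_count.
by case: (shapes s1 s2 m); case: b.
Qed.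

(* Only the words with [i] closed by [i.+1] distinguish [u] from [w]; deleting
   this matched pair of letters leaves the rest of the matching unchanged. *)
Lemma standard_count_11 :
  std u (g1 ++ [:: i, i.+1 & g2]) r + std w (g1 ++ g2) (i.+1 :: r)
  = std w (g1 ++ [:: i, i.+1 & g2]) r + std w (g1 ++ g2) (i :: r).
Proof.
rewrite /standard_count !size_cat /= !bitsum_cat -!bitsumD.
apply: eq_bitsum => s1 h1; rewrite /= -!bitsumD.
apply: eq_bitsum => s2 h2.
have E v m a1 x y a2 : size a1 = size g1 ->
  fits m v (mask (a1 ++ [:: x, y & a2]) (g1 ++ [:: i, i.+1 & g2]) ++ r)
  = fits m v (nseq x i ++ nseq y i.+1 ++ mask a1 g1 ++ mask a2 g2 ++ r).
  move=> h; apply: perm_fits; rewrite mask_cat //=.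
  by case: x; case: y; perm_count.
have E0 v m a1 a2 z : size a1 = size g1 ->
  fits m v (mask (a1 ++ a2) (g1 ++ g2) ++ z :: r)
  = fits m v (z :: mask a1 g1 ++ mask a2 g2 ++ r).
  by move=> h; apply: perm_fits; rewrite mask_cat //; perm_count.
rewrite !matched_cat !pending_cat /= !map_cat /= !E ?E0 ?size_map ?size_matched //.
set p := pending 0 s2.
have F m a1 a2 := shapes a1 a2 m.
set X := mask s1 g1 ++ mask s2 g2 ++ r.
rewrite /X; have F00 m a1 a2 : _ := let: And4 h _ _ _ := F m a1 a2 in h.
have F10 m a1 a2 : _ := let: And4 _ h _ _ := F m a1 a2 in h.
have F01 m a1 a2 : _ := let: And4 _ _ h _ := F m a1 a2 in h.
have F11 m a1 a2 : _ := let: And4 _ _ _ h := F m a1 a2 in h.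
have swap x y z t v : x + y + (z + t) + v = x + v + (z + t) + y by lia.
(* How [i] and [i.+1] are matched depends only on whether none, one or more parentheses are open to
   their right. Three of their four words contribute equally to both sides; [swap] trades the fourth
   for the shortened word. *)
by case: p => [|[|p]]; rewrite /= ?F11 ?F01 ?F10 ?F00 swap.
Qed.

End Lists.
End Recursion.

(** * The recursion in terms of exponents *)

Definition level (c : nat) (e : nat -> nat) (M : nat) : seq nat :=
  [seq j <- iota 0 M | e j == c].

(* Independent of [M] as soon as [e] vanishes from [M] on. *)
Definition exponent_count (k l : nat) (w : perm_nat) (e : nat -> nat) (M : nat) : nat :=
  if all (fun j => e j <= 2) (iota 0 M) then
    standard_count k l w (level 1 e M) (level 2 e M)
  else 0.

Definition set2 (e : nat -> nat) (i a b : nat) : nat -> nat :=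
  fun j => if j == i then a else if j == i.+1 then b else e j.

Lemma iota_split2 i M : i.+1 < M ->
  iota 0 M = iota 0 i ++ [:: i, i.+1 & iota i.+2 (M - i.+2)].
Proof.
move=> h; have {1}-> : M = i + (2 + (M - i.+2)) by lia.
by rewrite !iotaD /= !add0n addn2.
Qed.

Lemma set2l e i a b : set2 e i a b i = a.
Proof. by rewrite /set2 eqxx. Qed.

Lemma set2r e i a b : set2 e i a b i.+1 = b.
Proof. by rewrite /set2 (gtn_eqF (ltnSn i)) eqxx. Qed.

Lemma level_set2 c e i a b M : i.+1 < M ->
  level c (set2 e i a b) M =
  [seq j <- iota 0 i | e j == c] ++ nseq (a == c) i ++ nseq (b == c) i.+1
    ++ [seq j <- iota i.+2 (M - i.+2) | e j == c].
Proof.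
move=> h; rewrite /level (iota_split2 h) filter_cat /= set2l set2r.
congr (_ ++ _).
  by apply: eq_in_filter => j; rewrite mem_iota /set2 => hj; rewrite !ifN //; lia.
have -> : [seq j <- iota i.+2 (M - i.+2) | set2 e i a b j == c]
        = [seq j <- iota i.+2 (M - i.+2) | e j == c].
  by apply: eq_in_filter => j; rewrite mem_iota /set2 => hj; rewrite !ifN //; lia.
by case: (a == c); case: (b == c).
Qed.

Lemma all_set2 e i a b M : i.+1 < M ->
  all (fun j => set2 e i a b j <= 2) (iota 0 M) =
  [&& a <= 2, b <= 2 & all (fun j => e j <= 2) (iota 0 i ++ iota i.+2 (M - i.+2))].
Proof.
move=> h; rewrite (iota_split2 h) !all_cat /= set2l set2r andbCA; congr (_ && _).
rewrite andbCA; congr (_ && _); congr (_ && _).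
  by apply: eq_in_all => j; rewrite mem_iota /set2 => hj; rewrite !ifN //; lia.
by apply: eq_in_all => j; rewrite mem_iota /set2 => hj; rewrite !ifN //; lia.
Qed.

(* The coefficientwise form of [Q = pi_i F], multiplied by [x_i - x_(i+1)]. *)
Definition pi_rel (Q F : nat -> nat -> int) : Prop := forall a b,
  ((if a is a'.+1 then Q a' b else 0) - (if b is b'.+1 then Q a b' else 0)
   = (if a is a'.+1 then F a' b else 0) - (if b is b'.+1 then F b' a else 0))%R.

(** This is the cancellation of [x_i - x_(i+1)]: the equation at [(a.+1, b.+1)] determines
    [Q a.+1 b] from [Q a b.+1]. *)
Lemma pi_rel_uniq Q Q' F : pi_rel Q F -> pi_rel Q' F -> forall a b, Q a b = Q' a b.
Proof.
move=> h h'; elim=> [|a IH] b.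
  have e : (0 - Q 0 b = 0 - Q' 0 b)%R by rewrite (h 0 b.+1) (h' 0 b.+1).
  by move: e; rewrite !sub0r => /oppr_inj.
have e : (Q a b.+1 - Q a.+1 b = Q' a b.+1 - Q' a.+1 b)%R.
  by rewrite (h a.+1 b.+1) (h' a.+1 b.+1).
by move: e; rewrite IH => /addrI/oppr_inj.
Qed.

(** The equations encode how [pi_i] acts: [x_i] goes to [x_i + x_(i+1)], [x_(i+1)] to 0, [x_i^2] to
    [x_i^2 + x_i x_(i+1) + x_(i+1)^2] and [x_(i+1)^2] to [- x_i x_(i+1)], up to factors
    [x_i x_(i+1)]. The last equation is written without subtraction in order to stay in [nat]. *)
Lemma pi_rel_table (Q F : nat -> nat -> nat) :
  (forall a b, 2 < a \/ 2 < b -> Q a b = 0 /\ F a b = 0) ->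
  Q 0 0 = F 0 0 -> Q 2 2 = F 2 2 ->
  Q 1 0 = F 1 0 /\ Q 0 1 = F 1 0 -> Q 2 0 = F 2 0 /\ Q 0 2 = F 2 0 ->
  Q 2 1 = F 2 1 /\ Q 1 2 = F 2 1 -> Q 1 1 + F 0 2 = F 1 1 + F 2 0 ->
  pi_rel (fun a b => (Q a b)%:Z)%R (fun a b => (F a b)%:Z)%R.
Proof.
move=> h0 e00 e22 [e10 e01] [e20 e02] [e21 e12] e11.
have Q0 a b : 2 < a \/ 2 < b -> Q a b = 0 by case/h0.
have F0 a b : 2 < a \/ 2 < b -> F a b = 0 by case/h0.
have e11' : ((Q 1 1)%:Z = (F 1 1)%:Z + (F 2 0)%:Z - (F 0 2)%:Z)%R.
  by apply/eqP; rewrite eq_sym subr_eq -!PoszD e11.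
case=> [|[|[|[|a]]]] [|[|[|[|b]]]];
  rewrite ?(Q0 3 _ (or_introl isT)) ?(F0 3 _ (or_introl isT))
    ?(Q0 _ 3 (or_intror isT)) ?(F0 _ 3 (or_intror isT))
    ?(Q0 a.+3 _ (or_introl isT)) ?(F0 a.+3 _ (or_introl isT))
    ?(Q0 a.+4 _ (or_introl isT)) ?(F0 a.+4 _ (or_introl isT))
    ?(Q0 _ b.+3 (or_intror isT)) ?(F0 _ b.+3 (or_intror isT))
    ?(Q0 _ b.+4 (or_intror isT)) ?(F0 _ b.+4 (or_intror isT))
    ?(F0 b.+3 _ (or_introl isT)) ?(F0 _ a.+4 (or_intror isT))
    ?e00 ?e22 ?e10 ?e01 ?e20 ?e02 ?e21 ?e12 ?e11' ?subrr //;
  move: (F 1 1) (F 2 0) (F 0 2) => x y z; clear; lia.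
Qed.

Lemma exponent_count_pi k l (w : perm_nat) i e M :
  w \in Sinfty -> 0 < i -> len w < len (fsfun_comp (s_ i) w) -> i.+1 < M ->
  pi_rel (fun a b => (exponent_count k l (fsfun_comp (s_ i) w) (set2 e i a b) M)%:Z)%R
         (fun a b => (exponent_count k l w (set2 e i a b) M)%:Z)%R.
Proof.
move=> hw i0 hlen hM.
set u := fsfun_comp _ _.
pose out := all (fun j => e j <= 2) (iota 0 i ++ iota i.+2 (M - i.+2)).
pose g1 := [seq j <- iota 0 i | e j == 1].
pose g2 := [seq j <- iota i.+2 (M - i.+2) | e j == 1].
pose r := [seq j <- iota 0 i | e j == 2] ++ [seq j <- iota i.+2 (M - i.+2) | e j == 2].
have E v a b : exponent_count k l v (set2 e i a b) M =
    if [&& a <= 2, b <= 2 & out] then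
      standard_count k l v (g1 ++ nseq (a == 1) i ++ nseq (b == 1) i.+1 ++ g2)
        (nseq (a == 2) i ++ nseq (b == 2) i.+1 ++ r)
    else 0.
  rewrite /exponent_count all_set2 // !level_set2 //; case: ifP => // _.
  by apply: perm_standard_count; rewrite /r; perm_count.
have hu : uniq [:: i, i.+1 & g1 ++ g2 ++ r].
  have sub1 : subseq (g1 ++ g2) (iota 0 i ++ iota i.+2 (M - i.+2)).
    by rewrite cat_subseq ?filter_subseq.
  have e1 : g1 ++ g2 = [seq j <- iota 0 i ++ iota i.+2 (M - i.+2) | e j == 1].
    by rewrite filter_cat.
  have e2 : r = [seq j <- iota 0 i ++ iota i.+2 (M - i.+2) | e j == 2].
    by rewrite filter_cat.
  have un : uniq [:: i, i.+1 & iota 0 i ++ iota i.+2 (M - i.+2)].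
    have := iota_uniq 0 M; rewrite (iota_split2 hM).
    by rewrite (perm_uniq (permEl (perm_catCA _ [:: i; i.+1] _))).
  move: un; move: (iota 0 i ++ _) e1 e2 => s e1 e2.
  rewrite catA e1 e2 /= !inE !negb_or !mem_cat !mem_filter !negb_or cat_uniq.
  move=> /and3P[/andP[-> /negPf ->] /negPf -> us]; rewrite !andbF !filter_uniq //= andbT.
  apply/hasPn => j; rewrite !mem_filter => /andP[/eqP -> _].
  by rewrite andFb.
have H00 := standard_count_00 k l hw i0 hlen hu.
have H22 := standard_count_22 k l hw i0 hlen hu.
have H20 := standard_count_20 k l hw i0 hlen hu.
have H02 := standard_count_02 k l hw i0 hlen hu.
have H10 := standard_count_10 k l hw i0 hlen hu.
have H01 := standard_count_01 k l hw i0 hlen hu.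
have H21 := standard_count_21 k l hw i0 hlen hu.
have H12 := standard_count_12 k l hw i0 hlen hu.
have H11 := standard_count_11 k l hw i0 hlen hu.
apply: pi_rel_table => [a b hab||||||]; rewrite !E.
  by split; case: ifP => // /and3P[? ? _]; move: hab; lia.
all: by case: (out).
Qed.

(** * Polynomials and the operators pi_i *)

Lemma mcoeff_mono (m m' : mon) : ((mono m)@_m' = (m == m')%:R)%R.
Proof. exact: mcoeffU1. Qed.

Lemma mon_prodE (I : Type) (r : seq I) (F : I -> mon) v :
  (\big[mmul/mone]_(x <- r) F x : mon) v = \sum_(x <- r) F x v.
Proof.
apply: (big_morph (fun x : mon => x v)); last exact: cm1.
by move=> x y; rewrite cmM.
Qed.

Lemma Tmon_inr m j : (Tmon m) (inr j) = (0 < j <= m).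
Proof.
rewrite /Tmon mon_prodE.
under eq_bigr => v _ do rewrite /tvar cmU.
have [hj|hj] := boolP (0 < j <= m).
  rewrite (bigD1_seq j) ?iota_uniq ?mem_index_iota //= eqxx big1 ?addn0 // => v /negPf hv.
  by rewrite (inj_eq inr_inj) hv.
rewrite big1_seq // => v; rewrite mem_index_iota ltnS => /andP[_ hv].
by rewrite (inj_eq inr_inj); case: eqP hj => // <-; rewrite hv.
Qed.

Lemma Tmon_inl m j : (Tmon m) (inl j) = 0.
Proof.
rewrite /Tmon mon_prodE.
by rewrite big1 // => v _; rewrite /tvar cmU.
Qed.

Lemma prod_xvar_inl (r : seq nat) j : uniq r ->
  (\big[mmul/mone]_(v <- r) xvar v : mon) (inl j) = (j \in r).
Proof.
move=> ur; rewrite mon_prodE.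
under eq_bigr => v _ do rewrite /xvar cmU (inj_eq inl_inj) eq_sym.
have [hj|hj] := boolP (j \in r).
  by rewrite (bigD1_seq j) //= eqxx big1 ?addn0 // => v /negPf; rewrite eq_sym => ->.
by rewrite big1_seq // => v /andP[_ hv]; case: eqP hj => // ->; rewrite hv.
Qed.

Lemma prod_xvar_inr (r : seq nat) j : (\big[mmul/mone]_(v <- r) xvar v : mon) (inr j) = 0.
Proof.
rewrite mon_prodE.
by rewrite big1 // => v _; rewrite /xvar cmU.
Qed.

Lemma mcoeff_xvarM j (f : poly_xt) (m : mon) :
  ((mono (xvar j) * f)@_(mmul (xvar j) m) = f@_m)%R.
Proof.
rewrite /mono malgM_def fgmulUg raddf_sum [in RHS](monalgE f) raddf_sum /=.
apply: eq_bigr => m' _; rewrite mul1r !mcoeffU; congr (_ *+ _)%R; congr nat_of_bool.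
apply/eqP/eqP => [e|-> //]; apply/eqP/cmP => v.
by have := congr1 (fun x : mon => x v) e; rewrite !cmM => /addnI.
Qed.

Lemma mcoeff_xvarM0 j (f : poly_xt) (m : mon) : m (inl j) = 0 ->
  ((mono (xvar j) * f)@_m = 0)%R.
Proof.
move=> h; rewrite /mono malgM_def fgmulUg raddf_sum /= big1 // => m' _.
rewrite mcoeffU; case: eqP => // e.
by have := congr1 (fun x : mon => x (inl j)) e; rewrite h cmM cmUU.
Qed.

Definition smon (i : nat) (m : mon) : mon :=
  \big[mmul/mone]_(v <- finsupp m) iter (m v) (mmul (ucm (svar i v))) mone.

Lemma svarK i : involutive (svar i).
Proof. by case=> j //=; rewrite s_K. Qed.

Lemma smonE i (m : mon) v : smon i m v = m (svar i v).
Proof.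
have it n x : (iter n (mmul (ucm x)) mone : mon) v = n * (x == v).
  by elim: n => [|n IH] /=; rewrite ?cm1 // cmM IH cmU mulSn.
rewrite /smon mon_prodE.
under eq_bigr => x _ do rewrite it (inv_eq (svarK i)).
have [hu|hu] := boolP (svar i v \in finsupp m).
  rewrite (big_fsetD1 (svar i v)) //= eqxx muln1 big1_fset ?addn0 // => x.
  by rewrite !inE => /andP[/negPf ->]; rewrite muln0.
rewrite big1_fset ?fsfun_dflt // => x hx _.
by case: eqP hu => [<-|_ _]; rewrite ?hx ?muln0.
Qed.

Lemma smonK i : involutive (smon i).
Proof. by move=> m; apply/eqP/cmP => v; rewrite !smonE svarK. Qed.

Lemma smonM i m1 m2 : smon i (mmul m1 m2) = mmul (smon i m1) (smon i m2).
Proof. by apply/eqP/cmP => v; rewrite smonE !cmM !smonE. Qed.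

Lemma spolyE i (f : poly_xt) :
  (spoly i f = \sum_(m <- msupp f) (f@_m)%:MP * mono (smon i m))%R.
Proof.
rewrite /spoly mmapE; apply: eq_bigr => m _; congr (_ * _)%R.
by rewrite /smon mono_big; apply: eq_bigr => v _; rewrite mono_iter.
Qed.

Lemma mcoeff_spoly i (f : poly_xt) (m : mon) : ((spoly i f)@_m = f@_(smon i m))%R.
Proof.
rewrite spolyE raddf_sum [in RHS](monalgE f) raddf_sum /=; apply: eq_bigr => m' _.
by rewrite mcoeffCM mcoeff_mono mcoeffU mulr_natr (inv_eq (smonK i)).
Qed.

Lemma spolyB i (f g : poly_xt) : (spoly i (f - g) = spoly i f - spoly i g)%R.
Proof. exact: mmapB. Qed.

Lemma spolyD i (f g : poly_xt) : (spoly i (f + g) = spoly i f + spoly i g)%R.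
Proof. exact: mmapD. Qed.

Lemma spoly_mono i m : spoly i (mono m) = mono (smon i m).
Proof.
by apply/malgP => m'; rewrite mcoeff_spoly !mcoeff_mono (inv_eq (smonK i)).
Qed.

Lemma spoly_sum i (I : Type) (r : seq I) (F : I -> poly_xt) :
  (spoly i (\sum_(x <- r) F x) = \sum_(x <- r) spoly i (F x))%R.
Proof.
apply: (big_morph (spoly i)) => [f g|]; first exact: spolyD.
exact: mmap0.
Qed.

Lemma spolyM i (f g : poly_xt) : (spoly i (f * g) = spoly i f * spoly i g)%R.
Proof.
have U c m : spoly i << c *g m >>%R = << c *g smon i m >>%R.
  by apply/malgP => m'; rewrite mcoeff_spoly !mcoeffU (inv_eq (smonK i)).
have E h : (spoly i h = \sum_(m <- msupp h) << h@_m *g smon i m >>)%R.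
  rewrite spolyE; apply: eq_bigr => m _.
  by rewrite /mono malgM_def fgmulUU mulr1 mul1m.
rewrite (E f) (E g) (malgME f g) spoly_sum mulr_suml; apply: eq_bigr => m _.
rewrite spoly_sum mulr_sumr; apply: eq_bigr => m' _.
by rewrite U malgM_def fgmulUU smonM.
Qed.

(* The ring identities are stated over an abstract ring: rewriting with ring
   laws at [poly_xt] makes unification unfold its operations. *)
Lemma linear_relD (R : pzRingType) (d x y f f' sf sf' g g' : R) :
  (d * g = x * f - y * sf -> d * g' = x * f' - y * sf' ->
   d * (g + g') = x * (f + f') - y * (sf + sf'))%R.
Proof. by move=> h h'; rewrite !mulrDr h h' opprD addrACA. Qed.

Lemma linear_relB (R : pzRingType) (d x y f f' sf sf' g g' : R) :
  (d * g = x * f - y * sf -> d * g' = x * f' - y * sf' ->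
   d * (g - g') = x * (f - f') - y * (sf - sf'))%R.
Proof.
move=> h h'; rewrite !mulrBr h h' !opprB.
by rewrite addrACA [RHS]addrACA; congr (_ + _)%R; rewrite addrC.
Qed.

Lemma linear_relM (R : pzRingType) (d x y f sf g h : R) :
  (d * g = x * f - y * sf -> d * (g * h) = x * (f * h) - y * (sf * h))%R.
Proof. by rewrite mulrA => ->; rewrite mulrBl !mulrA. Qed.

Lemma is_piD i (f f' g g' : poly_xt) :
  is_pi i f g -> is_pi i f' g' -> is_pi i (f + f')%R (g + g')%R.
Proof. by rewrite /is_pi spolyD; exact: linear_relD. Qed.

Lemma is_piB i (f f' g g' : poly_xt) :
  is_pi i f g -> is_pi i f' g' -> is_pi i (f - f')%R (g - g')%R.
Proof. by rewrite /is_pi spolyB; exact: linear_relB. Qed.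

Lemma is_pi_sym i (f g h : poly_xt) :
  is_pi i f g -> spoly i h = h -> is_pi i (f * h)%R (g * h)%R.
Proof. by rewrite /is_pi spolyM => H ->; exact: linear_relM. Qed.

Lemma is_pi_fix i (h : poly_xt) : spoly i h = h -> is_pi i h h.
Proof. by rewrite /is_pi => ->; rewrite mulrBl. Qed.

Definition set2mon (m : mon) (i a b : nat) : mon :=
  mmul (divcm m (mmul (iter (m (inl i)) (mmul (xvar i)) mone)
                      (iter (m (inl i.+1)) (mmul (xvar i.+1)) mone)))
       (mmul (iter a (mmul (xvar i)) mone) (iter b (mmul (xvar i.+1)) mone)).

Lemma iter_xvar n i v : (iter n (mmul (xvar i)) mone : mon) v = n * (v == inl i).
Proof.
by elim: n => [|n IH] /=; rewrite ?cm1 // cmM IH /xvar cmU mulSn eq_sym.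
Qed.

Lemma set2mon_inl m i a b j :
  set2mon m i a b (inl j) = set2 (fun j => m (inl j)) i a b j.
Proof.
rewrite /set2mon !cmM divcmE !cmM !iter_xvar /set2 !(inj_eq inl_inj).
have [->|ji] := eqVneq j i.
  by rewrite (ltn_eqF (ltnSn i)) /= !muln0 !muln1 !addn0 subnn.
have [->|ji'] := eqVneq j i.+1; rewrite /= !muln0.
  by rewrite !muln1 !add0n subnn.
by rewrite !addn0 subn0.
Qed.

Lemma set2mon_inr m i a b j : set2mon m i a b (inr j) = m (inr j).
Proof. by rewrite /set2mon !cmM divcmE !cmM !iter_xvar !muln0 subn0 !addn0. Qed.

Lemma set2mon_id m i : set2mon m i (m (inl i)) (m (inl i.+1)) = m.
Proof.
apply/eqP/cmP => -[j|j]; last by rewrite set2mon_inr.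
by rewrite set2mon_inl /set2; case: eqP => [->|_] //; case: eqP => [->|].
Qed.

Lemma set2monSl m i a b : set2mon m i a.+1 b = mmul (xvar i) (set2mon m i a b).
Proof.
apply/eqP/cmP => -[j|j]; rewrite cmM /xvar cmU ?set2mon_inr ?set2mon_inl // /set2.
by rewrite (inj_eq inl_inj) (eq_sym i); case: eqP.
Qed.

Lemma set2monSr m i a b : set2mon m i a b.+1 = mmul (xvar i.+1) (set2mon m i a b).
Proof.
apply/eqP/cmP => -[j|j]; rewrite cmM /xvar cmU ?set2mon_inr ?set2mon_inl // /set2.
rewrite (inj_eq inl_inj) (eq_sym i.+1); have [->|_] := eqVneq j i.
  by rewrite (ltn_eqF (ltnSn i)).
by case: eqP.
Qed.

Lemma smon_set2mon m i a b : smon i (set2mon m i a b) = set2mon m i b a.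
Proof.
apply/eqP/cmP => -[j|j]; rewrite smonE /= ?set2mon_inr // !set2mon_inl /set2 s_E.
by do !case: eqP => //; lia.
Qed.

Lemma mcoeff_subr (f g f' g' : poly_xt) m :
  (f - g = f' - g' -> f@_m - g@_m = f'@_m - g'@_m)%R.
Proof. by move=> h; have := congr1 (mcoeff m) h; rewrite !mcoeffB. Qed.

Lemma is_pi_rel i (f g : poly_xt) m : is_pi i f g ->
  pi_rel (fun a b => g@_(set2mon m i a b))%R (fun a b => f@_(set2mon m i a b))%R.
Proof.
move=> h a b.
have L (q : poly_xt) : ((mono (xvar i) * q)@_(set2mon m i a b)
    = if a is a'.+1 then q@_(set2mon m i a' b) else 0)%R.
  case: a => [|a]; last by rewrite set2monSl mcoeff_xvarM.
  by rewrite mcoeff_xvarM0 // set2mon_inl set2l.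
have R (q : poly_xt) : ((mono (xvar i.+1) * q)@_(set2mon m i a b)
    = if b is b'.+1 then q@_(set2mon m i a b') else 0)%R.
  case: b {L} => [|b]; last by rewrite set2monSr mcoeff_xvarM.
  by rewrite mcoeff_xvarM0 // set2mon_inl set2r.
have S : ((mono (xvar i.+1) * spoly i f)@_(set2mon m i a b)
    = if b is b'.+1 then f@_(set2mon m i b' a) else 0)%R.
  by rewrite R; case: (b) => // b'; rewrite mcoeff_spoly smon_set2mon.
have eqB (x y z t x' y' z' t' : int) :
    (x = x' -> y = y' -> z = z' -> t = t' -> x - y = z - t -> x' - y' = z' - t')%R.
  by move=> -> -> -> ->.
apply: (eqB _ _ _ _ _ _ _ _ (L g) (R g) (L f) S); apply: mcoeff_subr.
exact: etrans (esym (mulrBl g (mono (xvar i)) (mono (xvar i.+1)))) h.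
Qed.

(** * The sets A_m(w) under s_i *)

Lemma in_sact i j (alpha : {fset nat}) : (j \in sact i alpha) = (s_ i j \in alpha).
Proof.
apply/imfsetP/idP => [[x /= xa ->]|ja]; first by rewrite s_K.
by exists (s_ i j); rewrite ?s_K.
Qed.

Lemma sactK i : involutive (sact i).
Proof. by move=> alpha; apply/fsetP => j; rewrite !in_sact s_K. Qed.

Lemma s_l i : s_ i i = i.+1.
Proof. by rewrite s_E eqxx. Qed.

Lemma s_r i : s_ i i.+1 = i.
Proof. by rewrite s_E eqxx (gtn_eqF (ltnSn i)). Qed.

Lemma sact_id i (alpha : {fset nat}) :
  (i \in alpha) = (i.+1 \in alpha) -> sact i alpha = alpha.
Proof.
move=> h; apply/fsetP => j; rewrite in_sact s_E.
by case: eqP => [->|_]; [|case: eqP => [->|]].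
Qed.

Lemma perm_enum_fset (alpha : {fset nat}) (r : seq nat) :
  uniq r -> alpha =i r -> perm_eq (enum_fset alpha) r.
Proof. by move=> ur e; apply: uniq_perm; rewrite ?fset_uniq. Qed.

Section Ideals.

Variables (w : perm_nat) (i : nat).
Hypotheses (hw : w \in Sinfty) (i0 : 0 < i).
Hypothesis hlen : len w < len (fsfun_comp (s_ i) w).

Local Notation u := (fsfun_comp (s_ i) w).

Lemma A_s_stay m (alpha : {fset nat}) :
  (i.+1 \in alpha -> i \in alpha) -> (alpha \in A m u) = (alpha \in A m w).
Proof. by move=> h; rewrite !in_A_fits; apply: fits_s => //; exact: fset_uniq. Qed.

Lemma enum_sact (alpha : {fset nat}) : i \in alpha -> i.+1 \notin alpha ->
  perm_eq (enum_fset alpha) (i :: enum_fset (alpha `\ i)) /\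
  perm_eq (enum_fset (sact i alpha)) (i.+1 :: enum_fset (alpha `\ i)).
Proof.
move=> hi hi'.
have e x : (x \in enum_fset (alpha `\ i)) = (x != i) && (x \in alpha) by rewrite -in_fsetD1.
split; apply: perm_enum_fset => [|j]; rewrite /= ?fset_uniq ?inE ?e ?eqxx //.
- by case: eqP => [->|_].
- by rewrite (negPf hi') andbF.
rewrite in_sact s_E; have [->|_] := eqVneq j i.
  by rewrite (negPf hi') (ltn_eqF (ltnSn i)).
by case: eqP.
Qed.

Lemma A_s_move m (alpha : {fset nat}) : i \in alpha -> i.+1 \notin alpha ->
  (sact i alpha \in A m u) = (alpha \in A m w).
Proof.
move=> hi hi'; have [p p'] := enum_sact hi hi'.
rewrite !in_A_fits (perm_fits m _ p) (perm_fits m _ p'); apply: fits_s_move => //.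
  by rewrite -[_ \in _]/(i \in alpha `\ i) in_fsetD1 eqxx.
by rewrite -[_ \in _]/(i.+1 \in alpha `\ i) in_fsetD1 (negPf hi') andbF.
Qed.

Lemma A_lower m (alpha : {fset nat}) : i \in alpha -> i.+1 \notin alpha ->
  sact i alpha \in A m w -> alpha \in A m w.
Proof.
move=> hi hi'; have [p p'] := enum_sact hi hi'.
by rewrite !in_A_fits (perm_fits m _ p) (perm_fits m _ p'); exact: fits_lower.
Qed.

Lemma in_Ai m (alpha : {fset nat}) :
  (alpha \in Ai m i w) = (alpha \in A m w) && (sact i alpha \notin A m w).
Proof. by rewrite /Ai; move: (A m w) => S; rewrite !inE. Qed.

(** [A m w] is closed under lowering [i.+1] to [i], so [s_i] can lead out of it only by raising
    [i]. *)
Lemma Ai_mem m (alpha : {fset nat}) : alpha \in Ai m i w ->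
  i \in alpha /\ i.+1 \notin alpha.
Proof.
rewrite in_Ai => /andP[ha hs].
have [hi|hi] := boolP (i \in alpha); have [hi'|hi'] := boolP (i.+1 \in alpha) => //.
- by move: hs; rewrite sact_id ?ha ?hi.
- have := @A_lower m (sact i alpha); rewrite sactK !in_sact s_l s_r => /(_ hi' hi ha).
  by rewrite (negPf hs).
- by move: hs; rewrite sact_id ?ha // (negPf hi) (negPf hi').
Qed.

(** Only sets with [i.+1] but without [i] can be new in [A m u], and these are tested by lowering
    them to a set of [A m w]. *)
Lemma in_A_s m (alpha : {fset nat}) :
  (alpha \in A m u) = (alpha \in A m w) || (sact i alpha \in Ai m i w).
Proof.
have [/andP[hi' hi]|h] := boolP ((i.+1 \in alpha) && (i \notin alpha)).
  have h1 : i \in sact i alpha by rewrite in_sact s_l.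
  have h2 : i.+1 \notin sact i alpha by rewrite in_sact s_r.
  rewrite in_Ai sactK -{1}(sactK i alpha) A_s_move //.
  by have := A_lower (m := m) h1 h2; rewrite sactK; do 2 case: (_ \in _) => //; move/(_ isT).
rewrite A_s_stay => [|hi']; last by move: h; rewrite hi' /= negbK.
suff -> : (sact i alpha \in Ai m i w) = false by rewrite orbF.
apply: contraNF h => /Ai_mem; rewrite !in_sact s_l s_r; case=> -> ->.
by [].
Qed.

Lemma sact_A_s m (alpha : {fset nat}) : (sact i alpha \in A m u) = (alpha \in A m u).
Proof.
have half beta : beta \in A m u -> sact i beta \in A m u.
  have [hi|hi] := boolP (i \in beta); have [hi'|hi'] := boolP (i.+1 \in beta).
  - by rewrite sact_id ?hi ?hi'.
  - by rewrite A_s_move // A_s_stay // => h; rewrite h in hi'.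
  - rewrite (in_A_s m beta) => /orP[h|]; rewrite in_A_s.
      by rewrite (A_lower (alpha := sact i beta)) ?sactK ?in_sact ?s_l ?s_r.
    by rewrite in_Ai => /andP[-> _].
  - by rewrite sact_id // (negPf hi) (negPf hi').
by apply/idP/idP => [/half|/half //]; rewrite sactK.
Qed.

Lemma big_A_s (V : nmodType) m (F : {fset nat} -> V) :
  (\sum_(alpha <- A m u) F alpha
   = \sum_(alpha <- A m w) F alpha + \sum_(alpha <- Ai m i w) F (sact i alpha))%R.
Proof.
rewrite -(big_map (sact i) xpredT F) -big_cat; apply: perm_big; apply: uniq_perm.
- exact: fset_uniq.
- rewrite cat_uniq map_inj_uniq ?fset_uniq ?andbT //=; last exact: inv_inj (sactK i).
  apply/hasPn => alpha /mapP[beta]; rewrite in_Ai => /andP[_ h] ->.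
  exact: h.
move=> alpha; rewrite mem_cat -{3}(sactK i alpha) mem_map; last exact: inv_inj (sactK i).
exact: in_A_s.
Qed.

Lemma big_sact_A_s (V : nmodType) m (F : {fset nat} -> V) :
  (\sum_(alpha <- A m u) F (sact i alpha) = \sum_(alpha <- A m u) F alpha)%R.
Proof.
rewrite -(big_map (sact i) xpredT F); apply: perm_big; apply: uniq_perm.
- by rewrite map_inj_uniq ?fset_uniq //; exact: inv_inj (sactK i).
- exact: fset_uniq.
move=> alpha; rewrite -{1}(sactK i alpha) mem_map; last exact: inv_inj (sactK i).
exact: sact_A_s.
Qed.

End Ideals.

Definition Nsum (w : perm_nat) (i m : nat) : poly_xt :=
  (\sum_(alpha <- Ai m i w) mono (mmul (xset (sact i alpha)) (Tmon m)))%R.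

Lemma linear_rel_sum (R : pzRingType) (I : eqType) (r : seq I) (d x y : R) (F G : I -> R) :
  (forall a, a \in r -> x * F a = y * G a)%R ->
  (d * 0 = x * (\sum_(a <- r) F a) - y * (\sum_(a <- r) G a))%R.
Proof.
move=> h; apply/esym; rewrite mulr0 !mulr_sumr -sumrB big1_seq // => a /andP[_ /h ->].
exact: subrr.
Qed.


Definition Ssum (m : nat) (w : perm_nat) : poly_xt :=
  (\sum_(alpha <- A m w) mono (mmul (xset alpha) (Tmon m)))%R.

Lemma xset_inl alpha j : xset alpha (inl j) = (j \in alpha).
Proof. by rewrite /xset prod_xvar_inl ?fset_uniq. Qed.

Lemma xset_inr alpha j : xset alpha (inr j) = 0.
Proof. exact: prod_xvar_inr. Qed.

Lemma smon_xset i alpha m :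
  smon i (mmul (xset alpha) (Tmon m)) = mmul (xset (sact i alpha)) (Tmon m).
Proof.
apply/eqP/cmP => -[j|j]; rewrite smonE !cmM ?Tmon_inl ?xset_inl ?xset_inr //=.
by rewrite in_sact.
Qed.

Section IdealPolys.

Variables (w : perm_nat) (i : nat).
Hypotheses (hw : w \in Sinfty) (i0 : 0 < i).
Hypothesis hlen : len w < len (fsfun_comp (s_ i) w).

Local Notation u := (fsfun_comp (s_ i) w).

Lemma Ssum_s m : (Ssum m u = Ssum m w + Nsum w i m)%R.
Proof. exact: (big_A_s hw i0 hlen). Qed.

Lemma spoly_Ssum m : spoly i (Ssum m u) = Ssum m u.
Proof.
rewrite /Ssum spoly_sum; under eq_bigr => alpha _ do rewrite spoly_mono smon_xset.
exact: (big_sact_A_s hw i0 hlen m (fun a => mono (mmul (xset a) (Tmon m)))).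
Qed.

(** Each term is killed by itself: [alpha] contains [i] but not [i.+1], hence
    [x_i x^(s_i alpha) = x_(i+1) x^alpha]. *)
Lemma is_pi_Nsum m : is_pi i (Nsum w i m) 0%R.
Proof.
rewrite /is_pi /Nsum spoly_sum.
apply: linear_rel_sum => alpha /(Ai_mem i0)[hi hi'].
rewrite spoly_mono smon_xset sactK.
apply: etrans (esym (monoM _ _)) (etrans _ (monoM _ _)).
congr (mono _).
apply/eqP/cmP => -[j|j]; rewrite !cmM ?Tmon_inl ?xset_inl ?xset_inr /xvar ?cmU //.
rewrite in_sact s_E !(inj_eq inl_inj) !(eq_sym _ j) !addn0.
case: (eqVneq j i) => [->|h]; first by rewrite hi (negPf hi') (ltn_eqF (ltnSn i)).
by case: (eqVneq j i.+1) => [->|_] //; rewrite hi (negPf hi').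
Qed.

End IdealPolys.

(** * The part of P_w of T-degree T_k T_l *)

Definition vanishes_off (S : mon -> Prop) (f : poly_xt) : Prop :=
  forall m, ~ S m -> f@_m = 0%R.

Lemma vanishes_off0 S : vanishes_off S 0%R.
Proof. by move=> m _; exact: mcoeff0. Qed.

Lemma vanishes_offD S f g :
  vanishes_off S f -> vanishes_off S g -> vanishes_off S (f + g)%R.
Proof. by move=> hf hg m hm; rewrite mcoeffD hf // hg // addr0. Qed.

Lemma vanishes_offN S f : vanishes_off S f -> vanishes_off S (- f)%R.
Proof. by move=> hf m hm; rewrite mcoeffN hf // oppr0. Qed.

Lemma vanishes_offB S f g :
  vanishes_off S f -> vanishes_off S g -> vanishes_off S (f - g)%R.
Proof. by move=> hf hg; apply/vanishes_offD/vanishes_offN. Qed.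

Lemma vanishes_off_mono (S : mon -> Prop) m : S m -> vanishes_off S (mono m).
Proof. by move=> hm m' hm'; rewrite mcoeff_mono; case: eqP => // e; rewrite -e in hm'. Qed.

Lemma vanishes_off_sum S (I : eqType) (r : seq I) (F : I -> poly_xt) :
  (forall x, x \in r -> vanishes_off S (F x)) -> vanishes_off S (\sum_(x <- r) F x)%R.
Proof.
elim: r => [|x r IH] h; first by rewrite big_nil; exact: vanishes_off0.
rewrite big_cons; apply: vanishes_offD; first by apply: h; rewrite mem_head.
by apply: IH => y yr; apply: h; rewrite inE yr orbT.
Qed.

Lemma vanishes_offM (S1 S2 S3 : mon -> Prop) f g :
  vanishes_off S1 f -> vanishes_off S2 g ->
  (forall m1 m2, S1 m1 -> S2 m2 -> S3 (mmul m1 m2)) -> vanishes_off S3 (f * g)%R.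
Proof.
move=> hf hg h m hm; apply/eqP; rewrite mcoeff_eq0; apply/negP.
case/msuppM_le => m1 [m2 [h1 h2 e]].
have n1 : ~ ~ S1 m1 by move=> /hf/eqP; rewrite mcoeff_eq0 h1.
have n2 : ~ ~ S2 m2 by move=> /hg/eqP; rewrite mcoeff_eq0 h2.
by apply: n1 => s1; apply: n2 => s2; apply: hm; rewrite e; exact: h.
Qed.

(** [pi_i] mixes only monomials that differ in the exponents of [x_i] and [x_(i+1)]. If [f] vanishes
    on such a family, 0 solves the relation for [g], and the solution is unique. *)
Lemma vanishes_off_pi (S : mon -> Prop) i f g :
  (forall m a b, S (set2mon m i a b) -> S m) ->
  is_pi i f g -> vanishes_off S f -> vanishes_off S g.
Proof.
move=> hS h hf m hm.
have hf' a b : (f@_(set2mon m i a b) = 0)%R by apply: hf => /hS.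
have := pi_rel_uniq (is_pi_rel m h) (Q' := fun _ _ => 0%R) _ (m (inl i)) (m (inl i.+1)).
rewrite set2mon_id; apply=> a b.
by case: a => [|a]; case: b => [|b]; rewrite ?hf' !subrr.
Qed.

Section TwoT.

Variables k l : nat.
Hypotheses (k0 : 0 < k) (hkl : k < l).

(** The t-part of [m] is [T_k^a T_l^b]. *)
Definition T_exponent (a b : nat) (m : mon) : Prop :=
  forall j, m (inr j) = a * (0 < j <= k) + b * (0 < j <= l).

(* The T-monomials are those with weakly decreasing t-exponents. *)
Definition T_shaped (m : mon) : Prop :=
  m (inr 0) = 0 /\ forall j, 0 < j -> m (inr j.+1) <= m (inr j).

Definition T_other (m : mon) : Prop :=
  T_shaped m /\ forall a b, a <= 1 -> b <= 1 -> ~ T_exponent a b m.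

Lemma T_exponent_shaped a b m : T_exponent a b m -> T_shaped m.
Proof.
move=> h; split=> [|j j0]; first by rewrite h !ltnn !muln0.
by rewrite !h j0 /= leq_add // leq_mul2l ?orbT; apply/orP; right; do 2 case: leqP => //; lia.
Qed.

Lemma T_exponentM a b a' b' m m' :
  T_exponent a b m -> T_exponent a' b' m' -> T_exponent (a + a') (b + b') (mmul m m').
Proof. by move=> h h' j; rewrite cmM h h' !mulnDl addnACA. Qed.

Lemma T_shapedM m m' : T_shaped m -> T_shaped m' -> T_shaped (mmul m m').
Proof.
move=> [h0 h] [h0' h']; split=> [|j j0]; first by rewrite cmM h0 h0'.
by rewrite !cmM leq_add ?h ?h'.
Qed.

Lemma T_exponent_inj a b a' b' m :
  T_exponent a b m -> T_exponent a' b' m -> a = a' /\ b = b'.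
Proof.
move=> h h'; have := h k; have := h l; rewrite h' => e1; rewrite h' => e2.
by move: e1 e2; rewrite k0 (ltn_trans k0 hkl) !leqnn (ltnW hkl) (leqNgt l k) hkl /=; lia.
Qed.

Lemma T_other_exponent a b m : T_exponent a b m -> (1 < a) || (1 < b) -> T_other m.
Proof.
move=> h hab; split=> [|a' b' ha' hb' h']; first exact: T_exponent_shaped h.
by have [e e'] := T_exponent_inj h h'; move: hab; rewrite e e'; lia.
Qed.

(** In [T_k^a T_l^b] the t-exponents are constant on [1..k] and on [k+1..l] and vanish beyond. Two
    weakly decreasing sequences whose sum is constant on a block are constant there themselves. So
    [m'] would be some [T_k^a' T_l^b'], with [b'] read off at [l] and [a'] as the drop from [k] to
    [l]. *)
Lemma T_otherM m m' : T_shaped m -> T_other m' -> T_other (mmul m m').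
Proof.
move=> hm [hm' h]; split=> [|a b ha hb hab]; first exact: T_shapedM.
move: hm hm' => [m0 hm] [m0' hm'].
have E j : m (inr j) + m' (inr j) = a * (0 < j <= k) + b * (0 < j <= l).
  by rewrite -hab cmM.
have mono_le (v : nat -> nat) : (forall j, 0 < j -> v j.+1 <= v j) ->
    forall x d, 0 < x -> v (x + d) <= v x.
  move=> hv x d x0; elim: d => [|d IH]; first by rewrite addn0.
  by rewrite addnS (leq_trans (hv _ _)) // addn_gt0 x0.
have mono_le' (v : nat -> nat) : (forall j, 0 < j -> v j.+1 <= v j) ->
    forall x y, 0 < x -> x <= y -> v y <= v x.
  by move=> hv x y x0 xy; rewrite -(subnKC xy); apply: mono_le.
have D := mono_le' (fun j => m (inr j)) hm.
have D' := mono_le' (fun j => m' (inr j)) hm'.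
have E1 := E 1; have El := E l; have Ek := E k.
have l0 : 0 < l by exact: ltn_trans k0 hkl.
apply: (h (m' (inr k) - m' (inr l)) (m' (inr l))).
- have := D k l k0 (ltnW hkl); move: Ek El.
  by rewrite k0 l0 !leqnn (ltnW hkl) (leqNgt l k) hkl /=; lia.
- by move: El; rewrite l0 leqnn (leqNgt l k) hkl /=; lia.
- have Dkl := D' k l k0 (ltnW hkl); move=> j.
  case: (posnP j) => [->|j0]; first by rewrite m0' /= !muln0.
  rewrite /=; case: (leqP j k) => jk.
    rewrite (leq_trans jk (ltnW hkl)) !muln1 subnK //.
    have := D j k j0 jk; have := D' j k j0 jk; have := E j; move: Ek.
    by rewrite j0 k0 jk leqnn (leq_trans jk (ltnW hkl)) (ltnW hkl) /=; lia.
  case: (leqP j l) => jl; rewrite ?muln0 ?muln1 ?add0n.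
    have := D j l j0 jl; have := D' j l j0 jl; have := E j; move: El.
    by rewrite j0 l0 jl leqnn (leqNgt j k) jk (leqNgt l k) hkl /=; lia.
  by have := E j; rewrite (leqNgt j k) jk (leqNgt j l) jl j0 /=; lia.
Qed.


(** [T_other] absorbs products only with [T_shaped] monomials; keeping both sides shaped makes the
    congruence multiplicative. *)
Definition T_cong (f g : poly_xt) : Prop :=
  [/\ vanishes_off T_shaped f, vanishes_off T_shaped g & vanishes_off T_other (f - g)%R].

Lemma mulr_subr2 (R : pzRingType) (f g f' g' : R) :
  (f * g - f' * g' = f * (g - g') + (f - f') * g')%R.
Proof. by rewrite mulrBr mulrBl addrA subrK. Qed.

Lemma T_cong_refl f : vanishes_off T_shaped f -> T_cong f f.
Proof. by move=> h; split=> //; rewrite subrr; exact: vanishes_off0. Qed.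

Lemma T_cong_trans f g h : T_cong f g -> T_cong g h -> T_cong f h.
Proof.
move=> [hf _ hfg] [_ hh hgh]; split=> //.
by rewrite -(subrKA g); exact: vanishes_offD.
Qed.

Lemma vanishes_shapedM f g :
  vanishes_off T_shaped f -> vanishes_off T_shaped g -> vanishes_off T_shaped (f * g)%R.
Proof. by move=> hf hg; apply: vanishes_offM hf hg _; exact: T_shapedM. Qed.

Lemma vanishes_exponent_shaped a b f :
  vanishes_off (T_exponent a b) f -> vanishes_off T_shaped f.
Proof. by move=> h m hm; apply: h => /T_exponent_shaped. Qed.

Lemma T_congM f g f' g' : T_cong f f' -> T_cong g g' -> T_cong (f * g)%R (f' * g')%R.
Proof.
move=> [hf hf' h1] [hg hg' h2]; split; try exact: vanishes_shapedM.
rewrite (mulr_subr2 f g f' g'); apply: vanishes_offD.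
  by apply: vanishes_offM hf h2 _; exact: T_otherM.
rewrite (mulrC (f - f')%R g').
by apply: vanishes_offM hg' h1 _; exact: T_otherM.
Qed.

Lemma T_shaped1 : vanishes_off T_shaped 1%R.
Proof.
by rewrite -mono1; apply: vanishes_off_mono; split=> [|j _]; rewrite !cm1.
Qed.

Lemma T_exponent_k beta : T_exponent 1 0 (mmul (xset beta) (Tmon k)).
Proof. by move=> j; rewrite cmM xset_inr Tmon_inr; lia. Qed.

Lemma T_exponent_l beta : T_exponent 0 1 (mmul (xset beta) (Tmon l)).
Proof. by move=> j; rewrite cmM xset_inr Tmon_inr; lia. Qed.

Lemma T_shaped_xT beta m : T_shaped (mmul (xset beta) (Tmon m)).
Proof.
split=> [|j j0]; rewrite !cmM !xset_inr !Tmon_inr //= j0 /= leq_add2l.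
by case: (leqP j.+1 m) => // h; rewrite (ltnW h).
Qed.

Lemma T_other_xT beta m : 0 < m -> m != k -> m != l ->
  T_other (mmul (xset beta) (Tmon m)).
Proof.
move=> m0 mk ml; split=> [|a b ha hb h]; first exact: T_shaped_xT.
have := h m; have := h m.+1; rewrite !cmM !xset_inr !Tmon_inr m0 ltnn leqnn /=.
by case: (ltngtP m k) mk => //; case: (ltngtP m l) ml => //=; lia.
Qed.

Lemma prod_step (R : comPzRingType) (y S : R) :
  ((1 - y) * (1 - S) - (1 - (y + S)) = y * S)%R.
Proof. by ring. Qed.

Lemma prod_step0 (R : pzRingType) (y : R) : ((1 - y) * 1 - 1 = - y)%R.
Proof. by rewrite mulr1 addrAC subrr sub0r. Qed.

(** For [m] equal to [k] or [l], a product of two terms already carries [T_m^2] and is discarded;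
    for all other [m] even the linear terms are. *)
Lemma T_cong_prod (I : Type) (r : seq I) (h : I -> {fset nat}) m : 0 < m ->
  T_cong (\prod_(x <- r) (1 - mono (mmul (xset (h x)) (Tmon m))))%R
    (if (m == k) || (m == l) then 1 - \sum_(x <- r) mono (mmul (xset (h x)) (Tmon m))
     else 1)%R.
Proof.
move=> m0.
have hy x : vanishes_off T_shaped (mono (mmul (xset (h x)) (Tmon m))).
  by apply: vanishes_off_mono; exact: T_shaped_xT.
have hS a b s : (forall x, T_exponent a b (mmul (xset (h x)) (Tmon m))) ->
    vanishes_off (T_exponent a b) (\sum_(x <- s) mono (mmul (xset (h x)) (Tmon m)))%R.
  move=> hx; elim: s => [|x s IHs]; first by rewrite big_nil; exact: vanishes_off0.
  by rewrite big_cons; apply: vanishes_offD => //; exact: vanishes_off_mono.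
have h1y x : vanishes_off T_shaped (1 - mono (mmul (xset (h x)) (Tmon m)))%R.
  exact: vanishes_offB T_shaped1 _.
elim: r => [|x r IH].
  rewrite !big_nil subr0 if_same; exact: T_cong_refl T_shaped1.
rewrite !big_cons; apply: T_cong_trans (T_congM (T_cong_refl (h1y x)) IH) _.
case: ifP => hm; last first.
  split; [by apply: vanishes_shapedM => //; exact: T_shaped1 | exact: T_shaped1 |].
  rewrite prod_step0; apply: vanishes_offN; apply: vanishes_off_mono.
  by case/norP: (negbT hm) => mk ml; exact: T_other_xT.
have [a [b [hab hx]]] : exists a b, (a + b = 1) /\
    forall x, T_exponent a b (mmul (xset (h x)) (Tmon m)).
  case/orP: hm => /eqP ->; first by exists 1, 0; split => // y; exact: T_exponent_k.
  by exists 0, 1; split => // y; exact: T_exponent_l.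
have hSr := hS a b r hx.
have hSs := vanishes_exponent_shaped hSr.
split.
- by apply: vanishes_shapedM => //; apply: vanishes_offB => //; exact: T_shaped1.
- by apply: vanishes_offB; [exact: T_shaped1 | exact: vanishes_offD].
rewrite prod_step; apply: vanishes_offM (vanishes_off_mono (hx x)) hSr _ => m1 m2 h1 h2.
by apply: T_other_exponent (T_exponentM h1 h2) _; lia.
Qed.

Lemma prod_two (R : comPzRingType) (c : nat -> R) M :
  l < M -> (forall m, m != k -> m != l -> c m = 1%R) ->
  (\prod_(1 <= m < M) c m = c k * c l)%R.
Proof.
move=> lM hc; rewrite (bigD1_seq k) ?iota_uniq ?mem_index_iota //=; last by lia.
rewrite -big_filter (bigD1_seq l) ?filter_uniq ?iota_uniq //=; last first.
  by rewrite mem_filter mem_index_iota; lia.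
rewrite big1_seq ?mulr1 // => m /andP[ml]; rewrite mem_filter => /andP[mk _].
exact: hc.
Qed.

Lemma prod_widen (R : pzRingType) (F : nat -> R) M M' :
  0 < M <= M' -> (forall m, M <= m -> F m = 1%R) ->
  (\prod_(1 <= m < M) F m = \prod_(1 <= m < M') F m)%R.
Proof.
move=> /andP[M0 MM] h; rewrite [RHS](@big_cat_nat _ _ _ M) //=.
rewrite [X in (_ * X)%R]big1_seq ?mulr1 // => m /andP[_].
by rewrite mem_index_iota => /andP[/h].
Qed.

Lemma T_cong_big (I : eqType) (r : seq I) (F c : I -> poly_xt) :
  (forall x, x \in r -> T_cong (F x) (c x)) ->
  T_cong (\prod_(x <- r) F x)%R (\prod_(x <- r) c x)%R.
Proof.
elim: r => [|x r IH] h; first by rewrite !big_nil; exact: T_cong_refl T_shaped1.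
rewrite !big_cons; apply: T_congM; first by apply: h; rewrite mem_head.
by apply: IH => y yr; apply: h; rewrite inE yr orbT.
Qed.

Lemma T_cong_N (w : perm_nat) i : w \in Sinfty -> 0 < i ->
  T_cong (Npoly w i) ((1 - Nsum w i k) * (1 - Nsum w i l))%R.
Proof.
move=> hw i0; rewrite /Npoly.
pose F m := (\prod_(alpha <- Ai m i w) (1 - mono (mmul (xset (sact i alpha)) (Tmon m))))%R.
pose c m := (if (m == k) || (m == l) then 1 - Nsum w i m else 1)%R.
pose M := (maxn l (maxn i (bound w))).+1.
have hc m : 0 < m -> T_cong (F m) (c m) by exact: T_cong_prod.
have e1 : (\prod_(1 <= m < (maxn i (bound w)).+1) F m = \prod_(1 <= m < M) F m)%R.
  apply: prod_widen => [|m hm]; first by rewrite /= ltnS leq_maxr.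
  by rewrite /F Ai_eq0 // big_seq_fset0.
have e2 : (\prod_(1 <= m < M) c m = (1 - Nsum w i k) * (1 - Nsum w i l))%R.
  rewrite (@prod_two _ c M); first by rewrite /c !eqxx orbT.
    by rewrite /M ltnS leq_maxl.
  by move=> m /negPf mk /negPf ml; rewrite /c mk ml.
rewrite -e2 e1; apply: T_cong_big => m; rewrite mem_index_iota => /andP[m0 _].
exact: hc.
Qed.

Lemma T_exponent_Nsum_k w i : vanishes_off (T_exponent 1 0) (Nsum w i k).
Proof.
by apply: vanishes_off_sum => a _; apply: vanishes_off_mono; exact: T_exponent_k.
Qed.

Lemma T_exponent_Nsum_l w i : vanishes_off (T_exponent 0 1) (Nsum w i l).
Proof.
by apply: vanishes_off_sum => a _; apply: vanishes_off_mono; exact: T_exponent_l.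
Qed.

Lemma expand_PN (R : comPzRingType) (p a b : R) :
  ((1 + p) * ((1 - a) * (1 - b)) - (1 + (p + a * b) - a - b)
   = p * a * b - p * a - p * b)%R.
Proof. by ring. Qed.

Lemma expand_E (R : comPzRingType) (p a b s t s' t' : R) :
  (s' = s + a -> t' = t + b ->
   (p + a * b) + (s' * t' - a * t' - b * s') = p + s * t)%R.
Proof. by move=> -> ->; ring. Qed.

Lemma is_pi_eq i (f f' g g' : poly_xt) : is_pi i f g -> f = f' -> g = g' -> is_pi i f' g'.
Proof. by move=> h <- <-. Qed.

Lemma collapse_E (R : comPzRingType) (p s t : R) :
  (p + (s * t - 0 * t - 0 * s) = p + s * t)%R.
Proof. by ring. Qed.

Lemma add_sub00 (R : pzRingType) (p : R) : (1 + p - 0 - 0 = 1 + p)%R.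
Proof. by rewrite !subr0. Qed.

(* [p + S_k S_l] is the coefficient of [T_k T_l] in [P_w] divided by the product
   of all [1 - x^alpha T_m] with alpha in [A_m(w)].  The index 0 must be excluded:
   at the identity the matching could move an element of [beta] to [0]. *)
Definition T_expansion (w : perm_nat) (P : poly_xt) : Prop :=
  exists p : poly_xt, [/\ vanishes_off (T_exponent 1 1) p, T_cong P (1 + p)%R &
    forall m M, T_exponent 1 1 m -> m (inl 0) = 0 ->
      (forall j, M <= j -> m (inl j) = 0) ->
      ((p + Ssum k w * Ssum l w)@_m
       = (exponent_count k l w (fun j => m (inl j)) M)%:Z)%R].

Lemma level_widen c e M M' : 0 < c -> M <= M' -> (forall j, M <= j -> e j = 0) ->
  level c e M = level c e M'.
Proof.
move=> c0 MM h; rewrite /level -(subnKC MM) iotaD filter_cat -[LHS]cats0; congr (_ ++ _).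
apply/esym/eqP; rewrite -size_eq0 size_filter -leqn0 leqNgt -has_count.
by apply/hasPn => j; rewrite mem_iota add0n => /andP[/h -> _]; rewrite eq_sym -lt0n.
Qed.

Lemma exponent_count_widen w e M M' : M <= M' -> (forall j, M <= j -> e j = 0) ->
  exponent_count k l w e M = exponent_count k l w e M'.
Proof.
move=> MM h; rewrite /exponent_count !(level_widen _ MM h) //; congr (if _ then _ else _).
rewrite -(subnKC MM) iotaD all_cat [X in _ && X](_ : _ = true) ?andbT //.
by apply/allP => j; rewrite mem_iota add0n => /andP[/h -> _].
Qed.

Lemma eq_exponent_count w e e' M : e =1 e' ->
  exponent_count k l w e M = exponent_count k l w e' M.
Proof.
move=> h; rewrite /exponent_count /level.
rewrite (eq_all (a2 := fun j => e' j <= 2)) => [|j]; last by rewrite h.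
rewrite (eq_filter (a2 := fun j => e' j == 1)) => [|j]; last by rewrite h.
by rewrite (@eq_filter _ (fun j => e j == 2) (fun j => e' j == 2)) => [|j]; last by rewrite h.
Qed.

Lemma T_expansion_s w i P Q :
  w \in Sinfty -> 0 < i -> len w < len (fsfun_comp (s_ i) w) ->
  T_expansion w P -> is_pi i (P * Npoly w i)%R Q ->
  T_expansion (fsfun_comp (s_ i) w) Q.
Proof.
move=> hw i0 hlen [p [hp hP hE]] hQ; set u := fsfun_comp _ _.
have hNk := T_exponent_Nsum_k w i; have hNl := T_exponent_Nsum_l w i.
set Nk := Nsum w i k in hNk; set Nl := Nsum w i l in hNl.
have hNN : vanishes_off (T_exponent 1 1) (Nk * Nl)%R.
  by apply: vanishes_offM hNk hNl _ => m1 m2; exact: T_exponentM.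
have hpN a b N : vanishes_off (T_exponent a b) N -> 0 < a + b ->
    vanishes_off T_other (p * N)%R.
  move=> h ab; apply: vanishes_offM hp h _ => m1 m2 h1 h2.
  by apply: T_other_exponent (T_exponentM h1 h2) _; lia.
have hsh := vanishes_exponent_shaped.
pose Y := (1 + (p + Nk * Nl) - Nk - Nl)%R.
have cY : T_cong (P * Npoly w i)%R Y.
  apply: T_cong_trans (T_congM hP (T_cong_N hw i0)) _; split.
  - apply: vanishes_shapedM; first by case: hP.
    by case: (T_cong_N hw i0).
  - apply: vanishes_offB (hsh _ _ _ hNl); apply: vanishes_offB (hsh _ _ _ hNk).
    by apply: vanishes_offD T_shaped1 _; apply: hsh; exact: vanishes_offD hp hNN.
  (* Every remaining term is a multiple of [p], which carries [T_k T_l], by a further [T_k] or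
     [T_l], so a square appears. *)
  rewrite expand_PN -(mulrA p Nk Nl).
  exact: vanishes_offB (vanishes_offB (hpN 1 1 _ hNN isT) (hpN 1 0 _ hNk isT)) (hpN 0 1 _ hNl isT).
have [p' hp'] := is_pi_ex i (p + Nk * Nl)%R.
have pi_p' : vanishes_off (T_exponent 1 1) p'.
  apply: vanishes_off_pi hp' (vanishes_offD hp hNN) => m a b h j.
  by rewrite -(set2mon_inr m i a b) h.
have spoly1 : spoly i 1%R = 1%R.
  rewrite -mono1 spoly_mono; congr mono; apply/eqP/cmP => v.
  by rewrite smonE !cm1.
(* The linear terms disappear under [pi_i], so the new value again has no part of T-degree [T_k] or
   [T_l]. *)
have piY : is_pi i Y (1 + p')%R.
  rewrite -(add_sub00 p').
  by do 2 (apply: is_piB; last exact: is_pi_Nsum); apply: is_piD hp'; exact: is_pi_fix.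
exists p'; split => //.
  have shp : vanishes_off T_shaped (1 + p')%R.
    exact: vanishes_offD T_shaped1 (hsh _ _ _ pi_p').
  split=> //.
    apply: vanishes_off_pi hQ _; last by case: cY.
    move=> m a b [h0 h]; split; first by rewrite -(set2mon_inr m i a b).
    by move=> j /h; rewrite !set2mon_inr.
  apply: (vanishes_off_pi (i := i) _ (is_piB hQ piY)); last by case: cY.
  move=> m a b [[h0 h] h']; split=> [|a' b' ha hb hm].
    split; first by rewrite -(set2mon_inr m i a b).
    by move=> j /h; rewrite !set2mon_inr.
  by apply: (h' a' b') => // j; rewrite set2mon_inr.
(* Substitute [S_m(w) = S_m(u) - N_m] in the product. The mixed products [N_k S_l(u)] and
   [N_l S_k(u)] are killed, since the invariant factor passes through [pi_i]. *)
have piE : is_pi i (p + Ssum k w * Ssum l w)%R (p' + Ssum k u * Ssum l u)%R.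
  have sS m : spoly i (Ssum m u) = Ssum m u by exact: spoly_Ssum.
  have e1 := expand_E p (Ssum_s hw i0 hlen k) (Ssum_s hw i0 hlen l).
  apply: (is_pi_eq _ e1 (collapse_E p' (Ssum k u) (Ssum l u))).
  have hSS : spoly i (Ssum k u * Ssum l u)%R = (Ssum k u * Ssum l u)%R.
    exact: etrans (spolyM _ _ _) (congr2 (@GRing.mul poly_xt) (sS k) (sS l)).
  exact: is_piD hp' (is_piB (is_piB (is_pi_fix hSS)
    (is_pi_sym (is_pi_Nsum w i0 k) (sS l))) (is_pi_sym (is_pi_Nsum w i0 l) (sS k))).
(* The window has to contain both [i] and [i.+1], even where the exponents of [m] there are 0. *)
move=> m M hm hm0 hM; pose M' := maxn M i.+2.
have hM' : M <= M' by exact: leq_maxl.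
rewrite (exponent_count_widen _ hM') //.
have hset a b j : M' <= j -> set2mon m i a b (inl j) = 0.
  move=> hj; have hij : i.+1 < j by apply: leq_trans hj; exact: leq_maxr.
  rewrite set2mon_inl /set2 (gtn_eqF hij) (gtn_eqF (ltnW hij)); apply: hM.
  exact: leq_trans hM' hj.
have hiM : i.+1 < M' by exact: leq_maxr.
have := pi_rel_uniq (is_pi_rel m piE) (Q' := fun a b =>
  (exponent_count k l u (set2 (fun j => m (inl j)) i a b) M')%:Z)%R _ (m (inl i)) (m (inl i.+1)).
rewrite set2mon_id => ->.
  congr Posz; apply: eq_exponent_count => j.
  by rewrite -set2mon_inl set2mon_id.
move=> a b; rewrite (exponent_count_pi k l (fun j => m (inl j)) hw i0 hlen hiM a b).
have IH a' b' : ((p + Ssum k w * Ssum l w)@_(set2mon m i a' b')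
    = (exponent_count k l w (set2 (fun j => m (inl j)) i a' b') M')%:Z)%R.
  have hT : T_exponent 1 1 (set2mon m i a' b') by move=> j; rewrite set2mon_inr.
  have h0 : set2mon m i a' b' (inl 0) = 0 by rewrite set2mon_inl /set2 (ltn_eqF i0).
  rewrite (hE _ M' hT h0 (hset a' b')).
  by congr Posz; apply: eq_exponent_count => j; rewrite set2mon_inl.
by congr (_ - _)%R; [case: (a) => // a' | case: (b) => // b']; rewrite -IH.
Qed.

End TwoT.

(** * The coefficients of S_k S_l and the identity *)

Definition pair_count (k l : nat) (w : perm_nat) (g r : seq nat) : nat :=
  bitsum (size g) (fun s => fits k w (mask s g ++ r) && fits l w (mask (map negb s) g ++ r)).

Lemma bitsum_sum (I : Type) (r : seq I) n (F : bitseq -> I -> nat) :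
  bitsum n (fun s => \sum_(x <- r) F s x) = \sum_(x <- r) bitsum n (F^~ x).
Proof. by elim: n F => //= n IH F; rewrite !IH big_split. Qed.

Lemma bitsum_pred1 n s0 : size s0 = n -> bitsum n (fun s => s == s0) = 1.
Proof.
elim: n s0 => [|n IH] [|b s0] //= [hs].
by case: b; rewrite /= ?(IH s0 hs) bitsum0.
Qed.

Lemma map_in_mask (g : seq nat) s : uniq g -> size s = size g ->
  [seq j \in mask s g | j <- g] = s.
Proof.
elim: s g => [|b s IH] [|x g] //= /andP[hx ug] [hs].
have hxm : x \notin mask s g by apply: contra hx; apply: mem_mask.
case: b => /=.
  rewrite mem_head; congr (_ :: _); rewrite -[RHS](IH g) //; apply/eq_in_map => j jg.
  by rewrite inE; case: eqP => // e; rewrite -e jg in hx.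
by rewrite (negPf hxm) IH.
Qed.

Lemma in_mask_map (g : seq nat) (P : pred nat) j :
  (j \in mask (map P g) g) = P j && (j \in g).
Proof. by rewrite -filter_mask mem_filter. Qed.

Lemma in_mask_negb (g : seq nat) s j : uniq g -> size s = size g ->
  (j \in mask (map negb s) g) = (j \in g) && (j \notin mask s g).
Proof.
move=> ug hs; rewrite -{1}(map_in_mask ug hs) -map_comp in_mask_map /= andbC.
by [].
Qed.

Lemma level_uniq c e M : uniq (level c e M).
Proof. by rewrite filter_uniq ?iota_uniq. Qed.

Lemma mem_level c e M j : (forall j, M <= j -> e j = 0) -> 0 < c ->
  (j \in level c e M) = (e j == c).
Proof.
move=> h c0; rewrite mem_filter mem_iota add0n; case: eqP => //= e'.
by rewrite ltnNge; apply/negP => /h; rewrite e'; lia.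
Qed.

Lemma uniq_mask_level e M s :
  uniq (mask s (level 1 e M) ++ level 2 e M).
Proof.
rewrite cat_uniq mask_uniq ?level_uniq // andbT; apply/hasPn => j.
rewrite mem_filter => /andP[/eqP ej _]; apply/negP => /mem_mask.
by rewrite mem_filter ej.
Qed.

Lemma fits_fset m w (r : seq nat) : uniq r ->
  fits m w r = ([fset j in r] \in A m w).
Proof.
move=> ur; rewrite in_A_fits; apply/esym/perm_fits/perm_enum_fset => // j.
by rewrite !inE.
Qed.

(** A pair corresponds to the word that marks [beta] among the elements of multiplicity one. The
    test [b] is left abstract so that an equality of monomials can take its place. *)
Lemma pair_count_sum k l w e M :
  (forall j, M <= j -> e j = 0) -> (forall j, e j <= 2) ->
  forall b : {fset nat} -> {fset nat} -> bool,
  (forall beta alpha, reflect (forall j, (j \in beta) + (j \in alpha) = e j) (b beta alpha)) ->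
  \sum_(beta <- A k w) \sum_(alpha <- A l w) b beta alpha
  = pair_count k l w (level 1 e M) (level 2 e M).
Proof.
move=> h0 h2 b bP; set g := level 1 e M; set r := level 2 e M.
have ug : uniq g by exact: level_uniq.
have inr j : (j \in r) = (e j == 2) by exact: mem_level.
have ing j : (j \in g) = (e j == 1) by exact: mem_level.
pose Bs s := [fset j in mask s g ++ r].
have inBs s j : (j \in Bs s) = (j \in mask s g) || (e j == 2) by rewrite in_fset mem_cat inr.
have E s : size s = size g ->
    (fits k w (mask s g ++ r) && fits l w (mask (map negb s) g ++ r) : nat)
    = \sum_(beta <- A k w) \sum_(alpha <- A l w)
        ((beta == Bs s) && (alpha == Bs (map negb s))).
  move=> hs; rewrite !fits_fset ?uniq_mask_level // -/(Bs s) -/(Bs (map negb s)).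
  have S (X : {fset {fset nat}}) x : \sum_(y <- X) (y == x) = (x \in X).
    have [hx|hx] := boolP (x \in X).
      by rewrite (bigD1_seq x) ?fset_uniq //= eqxx big1 // => y /negPf ->.
    by rewrite big1_seq // => y /andP[_ hy]; case: eqP hx => // <-; rewrite hy.
  under eq_bigr => beta _.
    under eq_bigr => alpha _ do rewrite -mulnb.
    rewrite -big_distrr /= S.
    over.
  by rewrite -big_distrl /= S mulnb.
rewrite /pair_count (eq_bitsum E) bitsum_sum; apply: eq_bigr => beta _.
rewrite bitsum_sum; apply: eq_bigr => alpha _.
case: bP => [H|H].
  have hb j : (j \in mask (map (mem beta) g) g) = (j \in beta) && (e j == 1).
    by rewrite in_mask_map ing.
  rewrite -[LHS]/1 -[LHS](@bitsum_pred1 (size g) (map (mem beta) g)) ?size_map //.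
  apply: eq_bitsum => s hs; congr nat_of_bool; apply/eqP/andP => [->|[/eqP eb _]]; last first.
    rewrite -[LHS](map_in_mask ug hs); apply/eq_in_map => j; rewrite ing => /eqP ej.
    by rewrite [RHS]/= eb inBs ej orbF.
  split; apply/eqP/fsetP => j; rewrite inBs ?in_mask_negb ?size_map // hb ?ing;
    by have := H j; case: (j \in beta); case: (j \in alpha) => <-.
rewrite bitsum0 // => s hs; apply/eqP; rewrite eqb0; apply/negP => /andP[/eqP e1 /eqP e2].
apply: H => j; rewrite e1 e2 !inBs in_mask_negb // ing.
have : j \in mask s g -> e j = 1 by move/mem_mask; rewrite ing => /eqP.
have := h2 j; case: (j \in mask s g) => [_ ->|] //.
by case: (e j) => [|[|[|]]].
Qed.

Lemma sum_mul_sum (R : pzRingType) (I J : Type) (r : seq I) (t : seq J) (F : I -> R)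
    (G : J -> R) (H : I -> J -> R) :
  (forall x y, F x * G y = H x y)%R ->
  ((\sum_(x <- r) F x) * (\sum_(y <- t) G y) = \sum_(x <- r) \sum_(y <- t) H x y)%R.
Proof.
move=> h; rewrite big_distrlr; apply: eq_bigr => x _; apply: eq_bigr => y _.
exact: h.
Qed.

Section Base.

Variables k l : nat.
Hypotheses (k0 : 0 < k) (hkl : k < l).

Lemma mcoeff_mulSS w m : ((Ssum k w * Ssum l w)@_m
  = (\sum_(beta <- A k w) \sum_(alpha <- A l w)
      (mmul (mmul (xset beta) (Tmon k)) (mmul (xset alpha) (Tmon l)) == m)%:R))%R.
Proof.
have -> : (Ssum k w * Ssum l w = \sum_(beta <- A k w) \sum_(alpha <- A l w)
    mono (mmul (mmul (xset beta) (Tmon k)) (mmul (xset alpha) (Tmon l))))%R.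
  by apply: sum_mul_sum => beta alpha; exact: esym (monoM _ _).
rewrite raddf_sum /=; apply: eq_bigr => beta _.
by rewrite raddf_sum /=; apply: eq_bigr => alpha _; exact: mcoeff_mono.
Qed.

Lemma mcoeff_pairs w m M : T_exponent k l 1 1 m -> (forall j, M <= j -> m (inl j) = 0) ->
  ((Ssum k w * Ssum l w)@_m =
   (if all (fun j => m (inl j) <= 2)%N (iota 0 M) then
      pair_count k l w (level 1 (fun j => m (inl j)) M) (level 2 (fun j => m (inl j)) M)
    else 0%N)%:Z)%R.
Proof.
move=> hT h0; rewrite mcoeff_mulSS.
pose b beta alpha := mmul (mmul (xset beta) (Tmon k)) (mmul (xset alpha) (Tmon l)) == m.
have bP beta alpha : reflect (forall j, (j \in beta) + (j \in alpha) = m (inl j)) (b beta alpha).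
  apply: (iffP (cmP _ _)) => h => [j|[j|j]].
  - by rewrite -h !cmM !xset_inl !Tmon_inl !addn0.
  - by rewrite -h !cmM !xset_inl !Tmon_inl !addn0.
  - by rewrite hT !cmM !xset_inr !Tmon_inr !mul1n.
transitivity ((\sum_(beta <- A k w) \sum_(alpha <- A l w) b beta alpha)%:R : int)%R.
  by rewrite natr_sum; apply: eq_bigr => beta _; rewrite natr_sum.
rewrite natz; congr Posz; case: ifP => [/allP h2|/allPn/= [j _ hj]].
  apply: pair_count_sum => // j; case: (leqP M j) => [/h0 ->|jM] //.
  by apply: h2; rewrite mem_iota.
rewrite big1 // => beta _; rewrite big1 // => alpha _; apply/eqP; rewrite eqb0.
apply: contra hj => /bP <-; by case: (_ \in _); case: (_ \in _).
Qed.

End Base.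

Lemma fits_id m (r : seq nat) : uniq r -> fits m [fsfun] r = perm_eq r (iota 1 m).
Proof.
have hid : ([fsfun] : perm_nat) \in Sinfty.
  by apply/andP; split; [apply/fsinjectiveP => x y; rewrite !fsfun0E | rewrite fsfun0E].
have hw : wseq [fsfun] m = iota 1 m.
  by apply: wseq_id => //; rewrite /bound finsupp0 big_seq_fset0.
move=> ur; apply/idP/idP => [/and3P[h0 /eqP hs h]|h]; last first.
  rewrite (perm_fits _ _ h) /fits mem_iota size_iota eqxx hw /=.
  rewrite (sorted_sort leq_trans (iota_sorted 1 m)).
  by elim: (iota 1 m) => //= x s ->; rewrite leqnn.
have sub : {subset r <= iota 1 m}.
  move=> j jr; have js : j \in sort leq r by rewrite mem_sort.
  have [y] := all2_leq_max h js.
  rewrite hw !mem_iota add1n !ltnS => /andP[_ ym] jy; rewrite (leq_trans jy ym) andbT lt0n.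
  by apply: contraNneq h0 => <-.
apply: uniq_perm; rewrite ?iota_uniq //.
by have [] := uniq_min_size ur sub; rewrite ?size_iota ?hs.
Qed.

(** At the identity the only sets are [{1, ..., k}] and [{1, ..., l}], and the first is contained in
    the second, so without matching only the word without [true] survives. With matching, a matched
    letter is at most [k] yet missing from the column [{1, ..., l}]; hence nothing is matched and,
    nothing being pending, nothing is marked. *)
Lemma standard_count_id k l e M : k < l -> e 0 = 0 ->
  (forall j, M <= j -> e j = 0) ->
  standard_count k l [fsfun] (level 1 e M) (level 2 e M)
  = pair_count k l [fsfun] (level 1 e M) (level 2 e M).
Proof.
move=> hkl e0 hM; set g := level 1 e M; set r := level 2 e M.
have ug : uniq g by exact: level_uniq.
have gs : sorted ltn g by rewrite sorted_filter ?iota_ltn_sorted //; exact: ltn_trans.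
have nr j : j \in g -> j \notin r by rewrite !mem_level // => /eqP ->.
have g0 j : j \in g -> 0 < j.
  by rewrite mem_level // lt0n => /eqP ej; apply: contraPneq ej => ->; rewrite e0.
apply: eq_bitsum => s hs; rewrite !fits_id ?uniq_mask_level //.
have P0 t : size t = size g -> mask t g = [::] -> t = nseq (size t) false.
  move=> ht h; apply/all_pred1P/allP => b bt; case: b bt => // bt.
  have : 0 < size (mask t g) by rewrite size_mask // -has_count; apply/hasP; exists true.
  by rewrite h.
congr nat_of_bool; apply/and3P/andP => [[/eqP hp hk hl]|[hk hl]].
  have ht0 : mask (matched 0 s) g = [::].
    have hle : all (leq^~ k) (mask (matched 0 s) g).
      apply: mask_matched_le => //; apply/allP => j jm.
      have : j \in iota 1 k by rewrite -(perm_mem hk) mem_cat jm.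
      by rewrite mem_iota add1n ltnS => /andP[].
    case E : (mask (matched 0 s) g) => [//|j t].
    have jm : j \in mask (matched 0 s) g by rewrite E mem_head.
    have jg := mem_mask jm.
    have : j \in iota 1 l.
      by rewrite mem_iota add1n ltnS g0 //= (leq_trans (allP hle _ jm)) // ltnW.
    rewrite -(perm_mem hl) mem_cat in_mask_negb ?size_matched // jm andbF.
    by rewrite (negPf (nr _ jg)).
  have et := P0 _ _ ht0; rewrite size_matched in et.
  have := count_matched 0 s; rewrite hp et // count_nseq /= => /esym/eqP.
  rewrite -leqn0 leqNgt -has_count.
  move=> hs0; have es : s = nseq (size s) false.
    by apply/all_pred1P; rewrite -[all _ _]negbK -has_predC; apply: contra hs0;
      apply: sub_has; case.
  have {}et : matched 0 s = s := etrans (et hs) (esym es).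
  by rewrite et in hl.
have hs0 : mask s g = [::].
  case E : (mask s g) => [//|j t].
  have jm : j \in mask s g by rewrite E mem_head.
  have : j \in iota 1 k by rewrite -(perm_mem hk) mem_cat jm.
  rewrite mem_iota add1n ltnS => /andP[j1 jk].
  have : j \in iota 1 l by rewrite mem_iota add1n ltnS j1 (leq_trans jk) // ltnW.
  rewrite -(perm_mem hl) mem_cat in_mask_negb // jm andbF /=.
  by rewrite (negPf (nr _ (mem_mask jm))).
have es := P0 _ hs hs0.
by rewrite es pending0_nseq matched0_nseq -es.
Qed.

Lemma T_expansion_id k l : 0 < k -> k < l -> T_expansion k l [fsfun] 1%R.
Proof.
move=> k0 hkl; exists 0%R; split; first exact: vanishes_off0.
  by rewrite addr0; apply: T_cong_refl; exact: T_shaped1.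
move=> m M hT m0 hM; rewrite add0r (mcoeff_pairs _ hT hM) /exponent_count.
by rewrite standard_count_id.
Qed.

Lemma T_expansion_isP k l w P : 0 < k -> k < l -> isP w P ->
  w \in Sinfty /\ T_expansion k l w P.
Proof.
move=> k0 hkl; elim=> [|v i R Q hR [hv IH] i0 hlen hQ].
  split; last exact: T_expansion_id.
  by apply/andP; split; [apply/fsinjectiveP => x y; rewrite !fsfun0E | rewrite fsfun0E].
split; first exact: Sinfty_s.
exact: T_expansion_s hQ.
Qed.

(** * The two-element case *)

Lemma msumE (alpha beta : {fset nat}) j : msum alpha beta j = (j \in alpha) + (j \in beta).
Proof. by rewrite /msum msetE2 !mset_seqE !count_uniq_mem ?fset_uniq. Qed.

Section Counting.

Variables (w : perm_nat) (eta : mset_nat) (M : nat).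
Hypotheses (hM : forall j, M <= j -> eta j = 0) (eta0 : eta 0 = 0).

Local Notation g := (level 1 eta M).
Local Notation r := (level 2 eta M).

Lemma in_g j : (j \in g) = (eta j == 1).
Proof. exact: mem_level. Qed.

Lemma in_r j : (j \in r) = (eta j == 2).
Proof. exact: mem_level. Qed.

Lemma in_eta1 j : (j \in eta1 eta) = (eta j == 1).
Proof.
rewrite !inE /= mem_finsupp andbC; case: eqP => //= ->.
by [].
Qed.

Lemma in_eta2 j : (j \in eta2 eta) = (eta j == 2).
Proof.
rewrite !inE /= mem_finsupp andbC; case: eqP => //= ->.
by [].
Qed.

Lemma g_sorted : sorted ltn g.
Proof. by rewrite sorted_filter ?iota_ltn_sorted //; exact: ltn_trans. Qed.

Lemma incr_eta1 : incr (eta1 eta) = g.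
Proof.
apply: (sorted_eq leq_trans anti_leq).
- exact: sort_sorted leq_total _.
- by apply: sub_sorted g_sorted => x y /ltnW.
rewrite perm_sort; apply: perm_enum_fset; first exact: level_uniq.
by move=> j; rewrite in_eta1 in_g.
Qed.

Lemma in_Aeta m (alpha : {fset nat}) : (alpha \in Aeta m eta w) =
  [&& alpha \in A m w, eta2 eta `<=` alpha & alpha `<=` eta1 eta `|` eta2 eta].
Proof. by rewrite /Aeta; move: (A m w) => S; rewrite !inE. Qed.

(** One direction is the maximality of [Y]; the other holds because [Y] itself satisfies the bounds
    of [A m w]. The common part [r] cancels from the counts. *)
Lemma fits_greatest m (Y : {fset nat}) x s :
  is_greatest (Aeta m eta w) Y -> perm_eq (enum_fset Y) (x ++ r) ->
  reflect (size (mask s g) = size x /\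
           forall j, count (leq^~ j) x <= count (leq^~ j) (mask s g))
    (fits m w (mask s g ++ r)).
Proof.
move=> [+ hmax] pY; rewrite in_Aeta in_A_fits => /and3P[/fitsP[_ sY hY] _ _].
have uL := uniq_mask_level eta M s.
apply: (iffP idP) => [h|[hs h]].
  have sE : size (mask s g) = size x.
    apply/eqP; rewrite -(eqn_add2r (size r)) -!size_cat -(perm_size pY) sY.
    by case/fitsP: h => _ -> _.
  split=> // j; have hL : [fset j in mask s g ++ r] \in Aeta m eta w.
    rewrite in_Aeta -fits_fset // h /=; apply/andP; split; apply/fsubsetP => y.
      by rewrite in_eta2 in_fset mem_cat in_r => ->; rewrite orbT.
    rewrite in_fset mem_cat in_r in_fsetU in_eta1 in_eta2.
    by case/orP => [/mem_mask|->]; rewrite ?in_g ?orbT // => ->.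
  have pL : perm_eq (enum_fset [fset j in mask s g ++ r]) (mask s g ++ r).
    by apply: perm_enum_fset => // y; rewrite in_fset.
  have hsz : size (incr [fset j in mask s g ++ r]) = size (incr Y).
    by rewrite !size_sort (perm_size pL) (perm_size pY) !size_cat sE.
  have := elimT (all2_leq_countP (sort_sorted leq_total _) (sort_sorted leq_total _) hsz)
    (hmax _ hL) j.
  rewrite !(permP (permEl (perm_sort _ _))) (permP pL) (permP pY) !count_cat.
  by rewrite leq_add2r.
apply/fitsP; split.
- rewrite mem_cat in_r eta0 orbF; apply/negP => /mem_mask.
  by rewrite in_g eta0.
- by rewrite size_cat hs -size_cat -(perm_size pY).
- move=> j; apply: leq_trans (hY j) _.
  by rewrite (permP pY) !count_cat leq_add2r.
Qed.

Lemma mask_sorted s : sorted ltn (mask s g).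
Proof. by apply: sorted_mask g_sorted; exact: ltn_trans. Qed.

Lemma ltn_sorted_leq (t : seq nat) : sorted ltn t -> sorted leq t.
Proof. by apply: sub_sorted => x y /ltnW. Qed.

Lemma count_negb (P : pred nat) s : size s = size g ->
  count P (mask s g) + count P (mask (map negb s) g) = count P g.
Proof.
elim: s (g) => [|b s IH] [|x t] //= [hs].
by rewrite -(IH t hs); case: b => /=; [rewrite addnA | rewrite addnCA].
Qed.

End Counting.

Lemma xeta_inl (eta : mset_nat) j : eta j <= 2 -> xeta eta (inl j) = eta j.
Proof.
have h2 : (\big[mmul/mone]_(v <- eta2 eta) mmul (xvar v) (xvar v) : mon) (inl j)
    = (j \in eta2 eta) + (j \in eta2 eta).
  by rewrite mon_prodE; under eq_bigr do rewrite cmM;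
    rewrite big_split -mon_prodE prod_xvar_inl ?fset_uniq.
rewrite /xeta cmM prod_xvar_inl ?fset_uniq // h2 in_eta1 in_eta2.
by case: (eta j) => [|[|[|]]].
Qed.

Lemma xeta_inr (eta : mset_nat) j : xeta eta (inr j) = 0.
Proof.
rewrite /xeta cmM prod_xvar_inr mon_prodE big1 // => v _.
by rewrite cmM /xvar cmU.
Qed.

Theorem theorem5p5 (w : perm_nat) (hw : w \in Sinfty)
    (k l : nat) (hkl : k < l)
    (eta : mset_nat) (hB : B k l w eta)
    (hcard : #|` eta1 eta| + 2 * #|` eta2 eta| = k + l)
    (hk : k = #|` eta2 eta| + 2)
    (alpha_max beta_max beta_min : {fset nat})
    (halpha_max : is_greatest (Aeta l eta w) alpha_max)
    (hbeta_max : is_greatest (Aeta k eta w) beta_max)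
    (hbeta_min : msum alpha_max beta_min = eta)
    (a b c d : nat)
    (hab : 0 < a /\ a < b /\ b <= l - k + 4)
    (hcd : 0 < c /\ c < d /\ d <= l - k + 4)
    (hbmin : beta_min = eta2 eta `|` [fset gam eta a; gam eta b])
    (hbmax : beta_max = eta2 eta `|` [fset gam eta c; gam eta d])
    (epsilon : int)
    (heps1 : c < b -> epsilon = 1%R)
    (heps0 : b < c -> epsilon = 0%R)
    (P : poly_xt) (hP : isP w P) :
  mcoef k l eta P
  = (d%:Z - a%:Z + 1 - epsilon * (b%:Z - c%:Z))%R.
Proof.
have k0 : 0 < k by rewrite hk addn2.
have [alpha0 [_ [beta0 [_ [[hal _ hbe _] [e0 _ _]]]]]] := hB.
have etaE j : eta j = (j \in alpha0) + (j \in beta0) by rewrite e0 msumE.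
have eta_le j : eta j <= 2 by rewrite etaE; do 2 case: (_ \in _).
have eta0 : eta 0 = 0.
  by move: hal hbe; rewrite etaE !in_A => /and3P[/negPf -> _ _] /and3P[/negPf -> _ _].
pose M := (\max_(j <- finsupp eta) j).+1.
have hM j : M <= j -> eta j = 0.
  move=> hj; apply: fsfun_dflt; apply/negP => je; move: hj; rewrite ltnNge => /negP.
  by apply; apply: leq_bigmax_seq.
pose g := level 1 eta M; pose r := level 2 eta M.
pose m := mmul (xeta eta) (mmul (Tmon k) (Tmon l)).
have m_inl j : m (inl j) = eta j.
  by rewrite cmM [X in _ + X]cmM !Tmon_inl !addn0 xeta_inl.
have mT : T_exponent k l 1 1 m.
  by move=> j; rewrite cmM [X in _ + X]cmM xeta_inr !Tmon_inr !mul1n.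
have mM j : M <= j -> m (inl j) = 0 by rewrite m_inl; exact: hM.
have m0 : m (inl 0) = 0 by rewrite m_inl.
have all2' : all (fun j => m (inl j) <= 2) (iota 0 M) by apply/allP => j _; rewrite m_inl.
have leveleq x : level x (fun j => m (inl j)) M = level x eta M.
  by apply: eq_filter => j; rewrite m_inl.
(* The constant 1 and the discarded terms have no coefficient at [m], so [P] has that of [p], which
   is the coefficient of [E_w] minus that of [S_k S_l]. *)
have coefE : mcoef k l eta P =
    ((pair_count k l w g r)%:Z - (standard_count k l w g r)%:Z)%R.
  have [_ [p [_ [_ _ hcong] hE]]] := T_expansion_isP k0 hkl hP.
  have hPm : (P@_m = p@_m)%R.
    have h1 : (1@_m = 0 :> int)%R.
      rewrite mcoeff1; case: eqP => // e; have := mT 1; rewrite e cm1; lia.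
    have := hcong m; rewrite mcoeffB mcoeffD h1 add0r => h.
    by apply/eqP; rewrite -subr_eq0 h // => -[_ /(_ 1 1 isT isT)].
  have := hE m M mT m0 mM; rewrite mcoeffD (mcoeff_pairs _ mT mM) /exponent_count all2' !leveleq.
  rewrite /mcoef -/m hPm -/g -/r => <-.
  by rewrite opprD addrCA subrr addr0.
rewrite coefE.
have hg : incr (eta1 eta) = g by exact: incr_eta1.
have ug : uniq g by exact: level_uniq.
have gs : sorted ltn g by exact: g_sorted.
have ing j : (j \in g) = (eta j == 1) by exact: in_g.
have inr j : (j \in r) = (eta j == 2) by exact: in_r.
have sr : size r = #|` eta2 eta|.
  apply/esym/perm_size/perm_enum_fset; first exact: level_uniq.
  by move=> j; rewrite in_eta2 inr.
have sg : size g = l - k + 4.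
  have : size g = #|` eta1 eta| by rewrite -hg size_sort.
  by lia.
move: hab hcd; rewrite -sg => -[a0 [ab bn]] [c0 [cd dn]].
have ab' : a.-1 < b.-1 < size g by lia.
have cd' : c.-1 < d.-1 < size g by lia.
move: hbmin hbmax; rewrite /gam hg.
set ga := nth 0 g a.-1; set gb := nth 0 g b.-1; set gc := nth 0 g c.-1; set gd := nth 0 g d.-1.
move=> hbmin' hbmax'.
have nth_g x : x < size g -> eta (nth 0 g x) = 1 by move=> hx; apply/eqP; rewrite -ing mem_nth.
have pairs p q : p < q < size g -> sorted ltn [:: nth 0 g p; nth 0 g q].
  by move=> h; rewrite -mask_pairword //; exact: mask_sorted.
have pb : perm_eq (enum_fset beta_max) ([:: gc; gd] ++ r).
  rewrite -(mask_pairword cd'); apply: perm_enum_fset => [|j].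
    exact: uniq_mask_level.
  rewrite hbmax' mem_cat mask_pairword // inr in_fsetU in_eta2 !inE orbC.
  by [].
pose xa := mask (map negb (pairword (size g) a.-1 b.-1)) g.
have spair p q : size (pairword (size g) p q) = size g by rewrite size_mkseq.
have pa : perm_eq (enum_fset alpha_max) (xa ++ r).
  apply: perm_enum_fset => [|j]; first exact: uniq_mask_level.
  have := msumE alpha_max beta_min j; rewrite hbeta_min hbmin' in_fsetU in_eta2 !inE.
  rewrite mem_cat inr in_mask_negb // mask_pairword // ing !inE -/ga -/gb.
  have h1 : (j == ga) || (j == gb) -> eta j = 1.
    by case/orP => /eqP ->; apply: nth_g; lia.
  case: ((j == ga) || (j == gb)) h1 => [h1|_]; first by rewrite h1 //; case: (_ \in _).
  by have := eta_le j; case: (eta j) => [|[|[|]]] // _; case: (_ \in _).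
have Ck s : size s = size g -> fits k w (mask s g ++ r) =
    (count id s == 2) && all2 leq (mask s g) [:: gc; gd].
  move=> hs; rewrite -(size_mask hs).
  apply/(fits_greatest hM eta0 s hbeta_max pb)/andP => [[h1 h2]|[/eqP h1 h2]]; split.
  - by rewrite h1.
  - by apply/all2_leq_countP => //; apply: ltn_sorted_leq; [exact: mask_sorted | exact: pairs].
  - by rewrite h1.
  - by apply/all2_leq_countP => //; apply: ltn_sorted_leq; [exact: mask_sorted | exact: pairs].
(* The counts of a mask and of its complement add up to those of [g], so the order is reversed: a
   complement below [alpha_max] means a pair above that of [beta_min]. *)
have Cl s : size s = size g -> count id s = 2 ->
    fits l w (mask (map negb s) g ++ r) = all2 leq [:: ga; gb] (mask s g).
  move=> hs h2; have hsm : size (mask s g) = 2 by rewrite size_mask.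
  have N Q : count Q (mask s g) + count Q (mask (map negb s) g)
      = count Q [:: ga; gb] + count Q xa.
    by rewrite -(mask_pairword ab') !count_negb.
  have sortedm : sorted leq (mask s g) by apply: ltn_sorted_leq; exact: mask_sorted.
  have sorteda : sorted leq [:: ga; gb] by apply: ltn_sorted_leq; exact: pairs.
  apply/(fits_greatest hM eta0 (map negb s) halpha_max pa)/idP => [[_ h]|h].
    apply/all2_leq_countP => // j; have := h j; have := N (leq^~ j).
    by move: (count _ (mask s g)) (count _ (mask (map negb s) g))
      (count _ xa) (count _ [:: ga; gb]); clear; lia.
  split.
    have := N predT; rewrite !count_predT hsm.
    by move=> e; apply: (@addnI 2); exact: e.
  move=> j; have := elimT (all2_leq_countP sorteda sortedm (esym hsm)) h j.
  have := N (leq^~ j).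
  by move: (count _ (mask s g)) (count _ (mask (map negb s) g))
      (count _ xa) (count _ [:: ga; gb]); clear; lia.
have [/andP[ha' hb'] /andP[hc' hd']] := (ab', cd').
have an : a.-1 < size g by exact: ltn_trans ha' hb'.
have cn : c.-1 < size g by exact: ltn_trans hc' hd'.
have count_pair p q : p < q < size g -> count id (pairword (size g) p q) = 2.
  by move=> h; rewrite -(size_mask (spair p q)) mask_pairword.
pose F1 s : nat := [&& count id s == 2, all2 leq (mask s g) [:: gc; gd] &
  all2 leq [:: ga; gb] (mask s g)].
pose F2 s : nat := [&& count id s == 2, pending 0 s == 0,
  all2 leq (mask s g) [:: gc; gd] & all2 leq [:: ga; gb] (mask (matched 0 s) g)].
have E1 : pair_count k l w g r =
    \sum_(q < size g) \sum_(p < q) [&& a.-1 <= p <= c.-1 & b.-1 <= q <= d.-1].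
  rewrite /pair_count (@eq_bitsum _ _ F1) => [|s hs]; last first.
    rewrite /F1 Ck // -andbA; case: eqP => //= h2; by rewrite Cl.
  rewrite bitsum_count2 => [|s /negPf hs]; last by rewrite /F1 hs.
  apply: eq_bigr => q _; apply: eq_bigr => p _; have hpq : p < q < size g by rewrite !ltn_ord.
  have qn : q < size g by [].
  have pn : p < size g by exact: ltn_trans (ltn_ord p) qn.
  rewrite /F1 count_pair // eqxx mask_pairword //= !leq_nth_sorted //.
  by rewrite !andbT andbACA [(p <= _) && _]andbC [(q <= _) && _]andbC.
have E2 : standard_count k l w g r =
    \sum_(q < size g) \sum_(p < q) standard_pair a.-1 b.-1 c.-1 d.-1 p q.
  rewrite /standard_count (@eq_bitsum _ _ F2) => [|s hs]; last first.
    rewrite /F2 Ck // -andbA andbCA; case: eqP => //= h2; case: eqP => //= h0.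
    (* With nothing pending, the matched word also has two letters [true], so [Cl] applies to it. *)
    have := count_matched 0 s; rewrite h0 h2 => hm.
    by rewrite Cl // size_matched.
  rewrite bitsum_count2 => [|s /negPf hs]; last by rewrite /F2 hs.
  apply: eq_bigr => q _; apply: eq_bigr => p _; have hpq : p < q < size g by rewrite !ltn_ord.
  by rewrite /F2 count_pair // eqxx -(standard_pairE gs ab' cd' hpq).
(* The decomposition [alpha0], [beta0] of [eta] yields a pair of elements of [eta_1] between that of
   [beta_min] and that of [beta_max]. *)
have [hac hbd] : a.-1 <= c.-1 /\ b.-1 <= d.-1.
  pose s0 := [seq j \in beta0 | j <- g].
  have hs0 : size s0 = size g by rewrite size_map.
  have f1 : fits k w (mask s0 g ++ r).
    move: hbe; rewrite in_A_fits (@perm_fits k w _ (mask s0 g ++ r)) //.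
    apply: perm_enum_fset => [|j]; first exact: uniq_mask_level.
    rewrite mem_cat in_mask_map ing inr etaE.
    by case: (j \in alpha0); case: (j \in beta0).
  have f2 : fits l w (mask (map negb s0) g ++ r).
    move: hal; rewrite in_A_fits (@perm_fits l w _ (mask (map negb s0) g ++ r)) //.
    apply: perm_enum_fset => [|j]; first exact: uniq_mask_level.
    rewrite mem_cat in_mask_negb // in_mask_map ing inr etaE.
    by case: (j \in alpha0); case: (j \in beta0).
  move: f1; rewrite Ck // => /andP[/eqP h2 h3]; move: f2; rewrite Cl // => h4.
  have : size (mask s0 g) = 2 by rewrite size_mask.
  case: (mask s0 g) h3 h4 => [|x [|y [|? ?]]] //= /and3P[xc yd _] /and3P[ax bY _] _.
  rewrite -(leq_nth_sorted gs) ?(leq_trans ax xc) //.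
  by rewrite -(leq_nth_sorted gs) ?(leq_trans bY yd).
rewrite E1 E2 (standard_pair_sum ha' cd' hac hbd) PoszD addrAC subrr add0r.
clear -a0 ab c0 cd hac hbd heps0 heps1.
case: (ltngtP b c) => hbc.
- rewrite heps0 // mul0r subr0 (_ : (b.-1 <= c.-1) = true); last by lia.
  by lia.
- rewrite heps1 // mul1r (_ : (b.-1 <= c.-1) = false); last by lia.
  by lia.
(* For [b = c] no value of [epsilon] is prescribed, but its factor [b - c] vanishes. *)
- by rewrite hbc subrr mulr0 subr0 leqnn; lia.
Qed.
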